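(* I. Assume that the Markov chain $X$ is $d$-Feller. Let $\mu$ be an invariant probability measure, and assume that for some $M\in\mathcal E\otimes\mathcal E$ with $(\mu\otimes\mu)(M)=1$ the following condition holds for each $(x,y)\in M$: (i) $\displaystyle\lim_{\varepsilon\downarrow0}\liminf_{n\to\infty}\sup_{\xi\in C(\mathbb P_x,\mathbb P_y)}\xi\big(d(X_n,Y_n)\le\varepsilon\big)>0.$ Then for every $\varepsilon>0$, $$\mu\big(\{x\in E: d(P_n(x,\cdot),\mu)>\varepsilon\}\big)\to0,\quad n\to\infty;$$ that is, $P_n(\cdot,\cdot)$, $n\ge 0$, considered as a sequence of $\mathcal P(E)$-valued random elements on $(E,\mathcal E,\mu)$, $d$-converges in probability to the random element identically equal to $\mu$. II. For $(x,y)\in E\times E$, the following condition is equivalent to (i): (ii) for some $p>1$ and $R\ge1$, $\displaystyle\lim_{\varepsilon\downarrow0}\liminf_{n\to\infty}\sup_{\xi\in\widehat C^R_p(\mathbb P_x,\mathbb P_y)}\xi\big(d(X_n,Y_n)\le\varepsilon\big)>0.$ Further, the following condition implies (ii) (and (i)): (iii) $\displaystyle\sup_{\xi\in\widehat C(\mathbb P_x,\mathbb P_y)}\lim_{\varepsilon\downarrow0}\liminf_{n\to\infty}\xi\big(d(X_n,Y_n)\le\varepsilon\big)>0.$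
   Context: Setting. $(E,\rho)$ is a Polish space ($\rho$ a complete separable metric, $\rho\le 1$) with Borel $\sigma$-algebra $\mathcal E$; $\mathcal P(E)$ is the set of probability measures on $E$. $X=\{X_n,n\in\mathbb Z_+\}$ is a Markov chain with state space $(E,\mathcal E)$, transition kernel $P(x,dy)$ and $n$-step transition probabilities $P_n(x,dy)$; $\mathbb P_x$ is the law of $X$ started at $x$ on $E^\infty:=E^{\mathbb Z_+}$. A probability measure $\mu$ on $E$ is invariant if $\mu(dy)=\int_E P(x,dy)\mu(dx)$. $d$ is a second metric on $E$, bounded and continuous with respect to $\rho$ (possibly $d=\rho$), not assumed complete. $\overline E^d$ is the completion of $E$ with respect to $d$, and it is assumed that for every $y\in E$ there are $d$-continuous functions $\rho^y_n:\overline E^d\to[0,\infty)$, $n\ge1$, with $\rho_n^y(x)\to\rho(x,y)$ for $x\in E$ and $\rho_n^y(x)\to\infty$ for $x\in\overline E^d\setminus E$. Measurability refers to $\rho$. $X$ is $d$-Feller if for each bounded $d$-continuous $f:E\to\mathbb R$ the map $x\mapsto\int f(y)P(x,dy)$ is $d$-continuous. For probability measures $\mu,\nu$ on a measurable space $S$, $C(\mu,\nu)$ is the set of probability measures on $S\times S$ with marginals $\pi_1=\mu$, $\pi_2=\nu$. For $\mu,\nu\in\mathcal P(E)$, $d(\mu,\nu):=\inf_{\eta\in C(\mu,\nu)}\int d(x,y)\,\eta(dx,dy)$. For probability measures $\mathbb P,\mathbb Q$ on $E^\infty$, $\widehat C(\mathbb P,\mathbb Q)$ is the set of probability measures $\xi$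 on $E^\infty\times E^\infty$ with $\pi_1(\xi)\ll\mathbb P$ and $\pi_2(\xi)\ll\mathbb Q$; $\widehat C^R_p(\mathbb P,\mathbb Q)$ is the set of $\xi\in\widehat C(\mathbb P,\mathbb Q)$ with $\big(\int(\tfrac{d\pi_1(\xi)}{d\mathbb P})^p d\mathbb P\big)^{1/p}\le R$ and $\big(\int(\tfrac{d\pi_2(\xi)}{d\mathbb Q})^p d\mathbb Q\big)^{1/p}\le R$. Under $\xi$, $(X_n)$ and $(Y_n)$ denote the first and second coordinate sequences on $E^\infty\times E^\infty$. *)

(* Defs.v *)
From HB Require Import structures.
From mathcomp Require Import all_boot all_order all_algebra.
From mathcomp Require Import all_classical all_reals all_analysis.

Set Implicit Arguments.
Unset Strict Implicit.
Unset Printing Implicit Defensive.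

Import Order.TTheory GRing.Theory Num.Theory.
Import numFieldNormedType.Exports.

Local Open Scope classical_set_scope.
Local Open Scope ring_scope.

Record metric_fun (R : realType) (T : Type) := MetricFun {
  metric_val :> T -> T -> R ;
  metric_xx : forall x, metric_val x x = 0 ;
  metric_pos : forall x y, metric_val x y = 0 -> x = y ;
  metric_symm : forall x y, metric_val x y = metric_val y x ;
  metric_tri : forall y x z, metric_val x z <= metric_val x y + metric_val y z }.

(* [mspace d] is the carrier of [d] seen as a metric space, so that a single
   type can carry several metrics; it is convertible to [T]. *)
Definition mspace (R : realType) (T : Type) (d : metric_fun R T) : Type := T.

Section mspace_instances.
Variables (R : realType) (T : choiceType) (d : metric_fun R T).

HB.instance Definition _ := Choice.copy (mspace d) T.
HB.instance Definition _ := @isMetric.Build R (mspace d) d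
  (metric_xx d) (@metric_pos _ _ d) (metric_symm d) (metric_tri d).

End mspace_instances.

Section metric_notions.
Variable R : realType.

(* The library's [completeType] is pointed, hence this unpointed version. *)
Definition metric_complete (T : metricType R) : Prop :=
  forall F : set_system T, ProperFilter F -> cauchy F ->
    exists l : T, F --> l.

Definition separable (T : topologicalType) : Prop :=
  exists2 S : set T, countable S & dense S.

Definition is_completion (T Tbar : metricType R) (iota : T -> Tbar) : Prop :=
  [/\ metric_complete Tbar,
      forall x y, mdist (iota x) (iota y) = mdist x y &
      dense (range iota)].

(* Every [rho x y], as a function of [x], is a pointwise limit of nonnegative
   continuous functions on the completion that diverge off [T]. *)
Definition completion_approx (T : choiceType) (rho : metric_fun R T)
    (Tbar : metricType R) (iota : T -> Tbar) : Prop :=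
  forall y : T, exists f : nat -> Tbar -> R,
    [/\ forall n, continuous (f n),
        forall n z, 0 <= f n z,
        forall x : T, f n (iota x) @[n --> \oo] --> rho x y &
        forall z : Tbar, ~ range iota z -> f n z @[n --> \oo] --> +oo].

End metric_notions.

Section measurable_projections.
Context d1 d2 (T1 : measurableType d1) (T2 : measurableType d2).

HB.instance Definition _ :=
  isMeasurableFun.Build _ _ (T1 * T2)%type T1 fst measurable_fst.
HB.instance Definition _ :=
  isMeasurableFun.Build _ _ (T1 * T2)%type T2 snd measurable_snd.

End measurable_projections.

Local Open Scope ereal_scope.

Section couplings.
Context dT (T : measurableType dT) (R : realType).

Definition marginal1 (xi : probability (T * T)%type R) : probability T R :=
  distribution xi (@fst T T).

Definition marginal2 (xi : probability (T * T)%type R) : probability T R :=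
  distribution xi (@snd T T).

Definition couplings (mu nu : set T -> \bar R) :
    set (probability (T * T)%type R) :=
  [set xi | forall A, measurable A -> marginal1 xi A = mu A /\
                                      marginal2 xi A = nu A].

Definition gcouplings (mu nu : probability T R) :
    set (probability (T * T)%type R) :=
  [set xi | marginal1 xi `<< mu /\ marginal2 xi `<< nu].

Definition density (nu mu : probability T R) : T -> \bar R :=
  Radon_Nikodym (charge_of_finite_measure nu) mu.

Definition gcouplings_bounded (p r : R) (mu nu : probability T R) :
    set (probability (T * T)%type R) :=
  [set xi | [/\ gcouplings mu nu xi,
                ('N[mu]_(p%:E)[density (marginal1 xi) mu] <= r%:E)%E &
                ('N[nu]_(p%:E)[density (marginal2 xi) nu] <= r%:E)%E]].

Definition coupling_dist (d : metric_fun R T) (mu nu : set T -> \bar R) :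
    \bar R :=
  ereal_inf [set \int[xi]_z (d z.1 z.2)%:E | xi in couplings mu nu].

End couplings.

Section paths.
Context dE (E : measurableType dE).

Definition cylinders (D : set nat) : set (set (nat -> E)) :=
  [set A | exists2 k, D k &
           exists2 B, measurable B & A = [set w : nat -> E | B (w k)]].

(* E^(Z_+) with the product sigma-algebra. *)
Definition paths := g_sigma_algebraType (cylinders [set: nat]).

Definition past (n : nat) : set (set paths) := <<s cylinders `I_n.+1 >>.

End paths.

Section markov.
Context dE (E : measurableType dE) (R : realType).
Implicit Types (P : R.-pker E ~> E) (d : metric_fun R E).

Fixpoint nstep P (n : nat) (x : E) (A : set E) : \bar R :=
  if n is m.+1 then \int[P x]_y nstep P m y A else \d_x A.

Definition invariant_prob P (mu : probability E R) : Prop :=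
  forall A, measurable A -> mu A = \int[mu]_x P x A.

(* [Q] is the law on path space of the chain with kernel [P] started at [x]:
   X_0 = x almost surely, and Q(X_(n+1) \in B | X_0, ..., X_n) = P(X_n, B). *)
Definition markov_law P (x : E) (Q : probability (paths E) R) : Prop :=
  (forall B, measurable B -> Q [set w : paths E | B (w 0%N)] = \d_x B) /\
  (forall n (A : set (paths E)) (B : set E), past n A -> measurable B ->
     Q (A `&` [set w : paths E | B (w n.+1)]) = \int[Q]_(w in A) P (w n) B).

Definition feller d P : Prop :=
  forall f : mspace d -> R, continuous f ->
    (exists c : R, forall x, (`|f x| <= c)%R) ->
    continuous (fun x : mspace d => (\int[P x]_y f y)%R).

Definition close_event d (e : R) (n : nat) : set (paths E * paths E) :=
  [set w | (d (w.1 n) (w.2 n) <= e)%R].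

(* For the [F] below, [limn_einf (F e)] is monotone in [e] with values in
   [0, 1], so the right limit at 0 exists. *)
Definition lim_liminf (F : R -> nat -> \bar R) : \bar R :=
  lim (limn_einf (F e) @[e --> 0%R^'+]).

Definition cond_i d (Q1 Q2 : probability (paths E) R) : Prop :=
  0 < lim_liminf (fun e n =>
        ereal_sup [set xi (close_event d e n) | xi in couplings Q1 Q2]).

Definition cond_ii d (Q1 Q2 : probability (paths E) R) : Prop :=
  exists p r : R, [/\ (1 < p)%R, (1 <= r)%R &
    0 < lim_liminf (fun e n =>
          ereal_sup [set xi (close_event d e n) |
                      xi in gcouplings_bounded p r Q1 Q2])].

Definition cond_iii d (Q1 Q2 : probability (paths E) R) : Prop :=
  0 < ereal_sup [set lim_liminf (fun e n => xi (close_event d e n)) |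
                  xi in gcouplings Q1 Q2].

End markov.

(* Main.v *)
Require Import Defs.
From HB Require Import structures.
From mathcomp Require Import all_boot all_order all_algebra.
From mathcomp Require Import all_classical all_reals all_analysis.
From mathcomp Require Import measurable_realfun.
From mathcomp Require Import ring lra.

Set Implicit Arguments.
Unset Strict Implicit.
Unset Printing Implicit Defensive.

Import Order.TTheory GRing.Theory Num.Theory.
Import numFieldNormedType.Exports.

Local Open Scope classical_set_scope.
Local Open Scope ring_scope.
Local Open Scope ereal_scope.

(** For a measurable set [A] put [p_n x = P_n(x, A)]. Given [X_0 ~ mu] the
    variance of [p_n (X_m)] conditionally on [X_0] has mean
    [|p_n|^2 - |p_(n+m)|^2] in [L^2(mu)], by the Markov property and invariance;
    as the norms decrease, it is small for [n] large, uniformly in [m]. So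
    [p_n] is nearly constant, equal to [p_(n+m) z], under [P_m(z, .)]. A coupling
    of the chains started at [z] and [w] that puts mass [q] on
    [d(X_m, Y_m) <= e] therefore yields
      [q * |p_(n+m) z - p_(n+m) w| <= u z + u w + L * e],
    where [u] has small integral and [L] is the Lipschitz constant of a function
    close to [p_n] in [L^1(mu)]. If [|p_m z - p_m w|] did not tend to [0] in
    [mu x mu]-probability, limsup sets would produce a pair of [M] at which
    (i) fails. Hence [P_n(., A) -> mu(A)] in [L^1(mu)] for every [A], and for a
    partition of [E] into cells of small [d]-diameter this gives convergence of
    the transport distance. Neither the Feller property nor the completeness of
    [rho] is involved: the approximations of [rho] on the completion ensure that
    [d] and [rho] have the same Borel sets.

    For Part II a generalized coupling is cut off where its marginal densities
    exceed a constant [K], divided by [K], and completed to a coupling. *)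

(** The obstacle is that (i) gives little control: the coupling may change with the time and with
    [e], and the lower bound on its mass depends on the pair. Couplings of different times cannot be
    combined, so only one time [m] is used, and the [n] steps after it are hidden in [p_n]. The
    function [p_n] has no regularity; it is replaced by a Lipschitz function with an error
    controlled in [L^1(mu)] only, and invariance carries this error to time [m] at no cost. The
    constant [L] depends on [n] and on the tolerance, so [e] has to shrink with the tolerance. This
    is harmless because the bound in (i) is the same for all [e], but it holds only for [m] large,
    depending on the pair and on [e]. Hence two nested limsup sets, over times at a fixed tolerance
    and then over tolerances tending to zero: a pair in both meets infinitely many bad times for
    arbitrarily small tolerances.

    A separate difficulty is that the transport distance is an infimum over an uncountable family.
    Its strict sublevel sets are described by finite plans between cells with rational entries, of
    which there are countably many; this gives measurability. *)

Lemma measure_subset d (T : measurableType d) (R : realType)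
    (mu : {measure set T -> \bar R}) A B :
  measurable A -> measurable B -> A `<=` B -> mu A <= mu B.
Proof. by move=> mA mB; apply: le_measure; rewrite inE. Qed.

Lemma nonincreasing_measure_small d (T : measurableType d) (R : realType)
    (mu : probability T R) (F : (set T)^nat) (e : R) :
  (forall n, measurable (F n)) -> (forall m n, (m <= n)%N -> F n `<=` F m) ->
  \bigcap_n F n = set0 -> (0 < e)%R -> exists n, mu (F n) <= e%:E.
Proof.
move=> mF ndF F0 e0.
have : (mu \o F) n @[n --> \oo] --> mu (\bigcap_n F n).
  apply: nonincreasing_cvg_mu => //.
  - by rewrite -ge0_fin_numE// fin_num_measure.
  - by rewrite F0.
  - by move=> m n mn; apply/subsetPset; exact: ndF.
rewrite F0 measure0 => /fine_cvgP[_] /cvgr0_norm_lt /(_ e e0) [N _ /(_ N)].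
rewrite /= leqnn => /(_ isT) Ne; exists N.
by rewrite -[leLHS]fineK ?fin_num_measure// lee_fin ltW// (le_lt_trans _ Ne)// ler_norm.
Qed.

Lemma integral_le_measure d (T : measurableType d) (R : realType)
    (mu : {measure set T -> \bar R}) (f : T -> \bar R) F :
  measurable F -> measurable_fun setT f -> (forall x, 0 <= f x) ->
  (forall x, f x <= (\1_F x)%:E) -> \int[mu]_x f x <= mu F.
Proof.
move=> mF mf f0 fF; rewrite -[X in mu X]setIT -integral_indic//.
apply: ge0_le_integral => //.
by apply/measurable_EFinP; exact: measurable_indic.
Qed.

(** * Completing a sub-coupling to a coupling *)

Section probability_of_measure.
Context d (T : measurableType d) (R : realType).
Variables (m : {measure set T -> \bar R}) (m1 : m setT = 1).

Definition probability_of_measure (_ : m setT = 1) : set T -> \bar R := m.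

HB.instance Definition _ := Measure.on (probability_of_measure m1).
HB.instance Definition _ :=
  Measure_isProbability.Build _ _ _ (probability_of_measure m1) m1.

End probability_of_measure.

Section measure_gap.
Context d (T : measurableType d) (R : realType).
Variables (mu : probability T R) (m : {measure set T -> \bar R}).
Hypothesis le_m : forall A, measurable A -> m A <= mu A.

(** A measure has to be nonnegative on every set, measurable or not, hence the [maxe 0]; on
    measurable sets it changes nothing. The proof is an argument so that the measure structure can
    be read off the term. *)
Definition measure_gap of (forall A, measurable A -> m A <= mu A) :
  set T -> \bar R := fun A => maxe 0 (mu A - m A).

Let fin_m A : measurable A -> m A \is a fin_num.
Proof.
move=> mA; rewrite ge0_fin_numE//.
by rewrite (le_lt_trans (le_m mA))// -ge0_fin_numE// fin_num_measure.
Qed.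

Lemma measure_gapE A : measurable A -> measure_gap le_m A = mu A - m A.
Proof.
by move=> mA; apply/max_idPr; rewrite sube_ge0 ?le_m// fin_m.
Qed.

Let gap0 : measure_gap le_m set0 = 0.
Proof. by rewrite measure_gapE// !measure0 subee. Qed.

Let gap_ge0 A : 0 <= measure_gap le_m A.
Proof. by rewrite /measure_gap le_max lexx. Qed.

Let gap_sigma : semi_sigma_additive (measure_gap le_m).
Proof.
move=> F mF tF mUF; rewrite measure_gapE//.
have -> : (fun n => \sum_(0 <= i < n) measure_gap le_m (F i)) =
    (fun n => \sum_(0 <= i < n) mu (F i) - \sum_(0 <= i < n) m (F i)).
  apply/funext => n; rewrite -fin_num_sumeN; last by move=> i _; exact: fin_m.
  rewrite -big_split/=; apply: eq_bigr => i _; exact: measure_gapE.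
apply: cvgeB.
- by rewrite fin_num_adde_defl// fin_numN fin_m.
- exact: measure_semi_sigma_additive.
- exact: measure_semi_sigma_additive.
Qed.

HB.instance Definition _ := isMeasure.Build _ T R (measure_gap le_m)
  gap0 gap_ge0 gap_sigma.

Let gap_fin : fin_num_fun (measure_gap le_m).
Proof.
by move=> A mA; rewrite measure_gapE// fin_numB fin_m// fin_num_measure.
Qed.

HB.instance Definition _ :=
  Measure_isFinite.Build _ _ _ (measure_gap le_m) gap_fin.

End measure_gap.

Section subcoupling.
Context d (T : measurableType d) (R : realType).

(* The missing mass is filled with a multiple of the product of the two
   residual measures. *)
Lemma subcoupling_extend (mu nu : probability T R)
    (m : {measure set (T * T) -> \bar R}) :
  (forall A, measurable A -> m (A `*` setT) <= mu A) ->
  (forall A, measurable A -> m (setT `*` A) <= nu A) ->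
  exists2 xi, couplings mu nu xi & forall C, measurable C -> m C <= xi C.
Proof.
move=> le1 le2.
have [m1 m1E] : exists m1 : {measure set T -> \bar R},
    forall A, m1 A = m (A `*` setT).
  unshelve eexists (pushforward m fst); first exact: measurable_fst.
  by move=> A; rewrite setXT.
have [m2 m2E] : exists m2 : {measure set T -> \bar R},
    forall A, m2 A = m (setT `*` A).
  unshelve eexists (pushforward m snd); first exact: measurable_snd.
  by move=> A; rewrite setTX.
have le1' A : measurable A -> m1 A <= mu A by rewrite m1E; exact: le1.
have le2' A : measurable A -> m2 A <= nu A by rewrite m2E; exact: le2.
pose g1 : {finite_measure set T -> \bar R} := measure_gap le1'.
pose g2 : {finite_measure set T -> \bar R} := measure_gap le2'.
have g1E A : measurable A -> g1 A = mu A - m1 A by exact: measure_gapE.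
have g2E A : measurable A -> g2 A = nu A - m2 A by exact: measure_gapE.
have mT_le1 : m setT <= 1.
  by rewrite -setXTT -(@probability_setT _ _ _ mu); exact: le1.
have mTfin : m setT \is a fin_num.
  by rewrite ge0_fin_numE// (le_lt_trans mT_le1)// ltry.
(* Both residuals have total mass [c], so [c^-1] times their product has them as marginals. If
   [c = 0] they vanish, and the convention [0^-1 = 0] gives the zero measure. *)
pose c := fine (1 - m setT).
have cE : c%:E = 1 - m setT by rewrite fineK// fin_numB mTfin.
have c0 : (0 <= c)%R by rewrite -lee_fin cE sube_ge0// mTfin.
have ci0 : (0 <= c^-1)%R by rewrite invr_ge0.
have g1T : g1 setT = c%:E by rewrite cE g1E// probability_setT m1E setXTT.
have g2T : g2 setT = c%:E by rewrite cE g2E// probability_setT m2E setXTT.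
have cK (g : {measure set T -> \bar R}) A : g setT = c%:E -> measurable A ->
    c^-1%:E * (g A * c%:E) = g A.
  move=> gT mA; have gAc : g A <= c%:E by rewrite -gT le_measure ?inE.
  have gAfin : g A \is a fin_num.
    by rewrite ge0_fin_numE// (le_lt_trans gAc)// ltry.
  have [cz|cnz] := eqVneq c 0%R.
    move: gAc; rewrite cz => gAc; have -> : g A = 0.
      by apply/eqP; rewrite eq_le gAc measure_ge0.
    by rewrite mul0e mule0.
  by rewrite muleCA -EFinM mulVf// mule1.
have g1K A : measurable A -> c^-1%:E * (g1 A * c%:E) = g1 A by exact: cK.
have g2K A : measurable A -> c^-1%:E * (g2 A * c%:E) = g2 A by exact: cK.
pose xi : {measure set (T * T) -> \bar R} :=
  measure_add m (mscale (NngNum ci0) (g1 \x g2)).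
have xiE A : xi A = m A + c^-1%:E * (g1 \x g2) A by exact: measure_addE.
have xi1 A : measurable A -> xi (A `*` setT) = mu A.
  move=> mA; rewrite xiE product_measure1E//= g2T g1K// g1E// m1E.
  by rewrite addeC subeK// ge0_fin_numE// (le_lt_trans (le1 _ mA))// -ge0_fin_numE// fin_num_measure.
have xi2 A : measurable A -> xi (setT `*` A) = nu A.
  move=> mA; rewrite xiE product_measure1E//= g1T [X in _ * X]muleC g2K// g2E// m2E.
  by rewrite addeC subeK// ge0_fin_numE// (le_lt_trans (le2 _ mA))// -ge0_fin_numE// fin_num_measure.
have xiT : xi setT = 1 by rewrite -setXTT xi1// probability_setT.
exists (probability_of_measure xiT) => [A mA|C mC].
  split.
  - by rewrite -(xi1 _ mA) setXT.
  - by rewrite -(xi2 _ mA) setTX.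
by rewrite /probability_of_measure xiE leeDl// mule_ge0.
Qed.

End subcoupling.

(** * Mixtures, limsup sets and the double limit *)

Section mixture.
Import HBNNSimple.

(** An identity known on sets passes to simple functions by linearity and to nonnegative functions
    by monotone convergence. It is stated for a bare family of measures so that it applies to the
    laws of the chain at a fixed time. *)
Lemma integral_mixture d d' (Y : measurableType d) (Z : measurableType d')
    (R : realType) (m : {measure set Y -> \bar R})
    (k : Y -> {measure set Z -> \bar R}) (nu : {measure set Z -> \bar R}) :
  (forall A, measurable A -> measurable_fun [set: Y] (k ^~ A)) ->
  (forall A, measurable A -> nu A = \int[m]_y k y A) ->
  forall f : Z -> \bar R, (forall z, 0 <= f z) -> measurable_fun setT f ->
  \int[nu]_z f z = \int[m]_y \int[k y]_z f z.
Proof.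
move=> mk nuE f f0 mf.
pose f_ := nnsfun_approx measurableT mf.
have f_0 n z : 0 <= (f_ n z)%:E by rewrite lee_fin.
have mf_ n : measurable_fun setT (EFin \o f_ n) by exact/measurable_EFinP.
have ndf_ z : {homo (fun n => (f_ n z)%:E) : a b / (a <= b)%N >-> a <= b}.
  by move=> a b ab; rewrite lee_fin; exact/lefP/nd_nnsfun_approx.
have limf z : limn (fun n => (f_ n z)%:E) = f z.
  by apply/cvg_lim => //; exact: cvg_nnsfun_approx.
have lim_int (l : {measure set Z -> \bar R}) :
    \int[l]_z f z = limn (fun n => \int[l]_z (f_ n z)%:E).
  rewrite -monotone_convergence//; apply: eq_integral => z _.
  by rewrite limf.
rewrite lim_int.
under [RHS]eq_integral do rewrite lim_int.
rewrite monotone_convergence//.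
- congr (limn _); apply/funext => n.
  have int_f_ (l : {measure set Z -> \bar R}) : \int[l]_z (f_ n z)%:E =
      \sum_(r \in range (f_ n)) r%:E * l (f_ n @^-1` [set r]).
    under eq_integral do rewrite fimfunE -fsumEFin//.
    rewrite ge0_integral_fsum//; last 2 first.
    - by move=> r; exact/measurable_EFinP/measurableT_comp.
    - by move=> r z _; rewrite EFinM nnfun_muleindic_ge0.
    apply: eq_fsbigr => r _; rewrite integralZl_indic_nnsfun// integral_indic//.
    by rewrite setIT.
  rewrite int_f_; under [RHS]eq_integral do rewrite int_f_.
  (* A negative [r] contributes nothing: [f_ n] is nonnegative, so the preimage is empty. *)
  have r0 r y : 0 <= r%:E * k y (f_ n @^-1` [set r]).
    have [r_ge0|r_lt0] := leP 0%R r; first by rewrite mule_ge0.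
    by rewrite preimage_nnfun0// measure0 mule0.
  have mkr r : measurable_fun setT (fun y => r%:E * k y (f_ n @^-1` [set r])).
    by apply: measurable_funeM; exact: mk.
  rewrite ge0_integral_fsum//.
  apply: eq_fsbigr => r _.
  have [r_ge0|r_lt0] := leP 0%R r.
    by rewrite nuE// ge0_integralZl_EFin//; exact: mk.
  rewrite preimage_nnfun0// measure0 mule0 integral0_eq// => y _.
  by rewrite measure0 mule0.
- by move=> n; apply: measurable_fun_integral_kernel => //; exact: mf_.
- by move=> n y _; exact: integral_ge0.
- by move=> y _ a b ab; apply: ge0_le_integral;
    rewrite //; [exact: mf_ | exact: mf_ | move=> z _; exact: ndf_].
Qed.

End mixture.

(** A reverse Fatou lemma: the tail unions decrease to the limsup set, each contains some [F n] of
    measure at least [t], and a finite measure is continuous from above. *)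
Lemma frequently_lim_sup_set d (T : measurableType d) (R : realType)
    (mu : {measure set T -> \bar R}) (F : (set T)^nat) (t : \bar R) :
  mu setT < +oo -> (forall n, measurable (F n)) ->
  (forall m, exists2 n, (m <= n)%N & t <= mu (F n)) ->
  t <= mu (lim_sup_set F).
Proof.
move=> muT mF tF.
have mU n : measurable (\bigcup_(j >= n) F j).
  by apply: bigcup_measurable => j _.
have cvgF : mu (\bigcup_(k >= n) F k) @[n --> \oo] --> mu (lim_sup_set F).
  apply: lim_sup_set_cvg => //.
  by apply: le_lt_trans muT; apply: le_measure; rewrite ?inE.
rewrite -(cvg_lim _ cvgF)//; apply: lime_ge; first exact: cvgP cvgF.
apply: nearW => m; have [n mn tn] := tF m.
by rewrite (le_trans tn)// le_measure ?inE//; exact: bigcup_sup.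
Qed.

(** By monotonicity the right limit at 0 is an infimum over []0, 1[], so its positivity yields one
    constant [c] valid for all [e]; only the rank from which the bound holds depends on [e]. *)
Lemma lim_liminf_gt0 (R : realType) (F : R -> nat -> \bar R) :
  (forall e e' n, (e <= e')%R -> F e n <= F e' n) ->
  0 < lim_liminf F <->
  exists2 c : R, (0 < c)%R &
    forall e, (0 < e)%R -> \forall n \near \oo, c%:E <= F e n.
Proof.
move=> ndF.
have nd : {in `]0%R, 1%R[ &, nondecreasing_fun (fun e => limn_einf (F e))}.
  move=> e e' _ _ ee'; rewrite !limn_einf_lim.
  apply: lee_lim; [exact: is_cvg_einfs..|].
  apply: nearW => n; apply: le_ereal_inf_tmp => _ [m nm <-].
  by rewrite (le_trans _ (ndF _ _ _ ee'))//; apply: ereal_inf_lbound; exists m.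
have := @nondecreasing_at_right_cvge R _ 0%R (BLeft 1%R) _ nd.
rewrite bnd_simp => /(_ ltr01) cvg_inf.
rewrite /lim_liminf (cvg_lim _ cvg_inf)//.
set I := ereal_inf _; split=> [I0|[c c0 cF]].
  (* The strict inequality is needed to pick, from the supremum behind the liminf, a rank with a
     tail above [c]. *)
  have [c c0 cI] : exists2 c : R, (0 < c)%R & c%:E < I.
    move: I0; case: I => [r|_|//]; last by exists 1%R => //; exact: ltry.
    by rewrite lte_fin => r0; exists (r / 2)%R; rewrite ?lte_fin; lra.
  exists c => // e e0; pose e' := Num.min e (2^-1)%R.
  have : c%:E < limn_einf (F e').
    apply: (lt_le_trans cI); apply: ereal_inf_lbound; exists e' => //.
    rewrite /= in_itv/= /e' lt_min e0 invr_gt0 ltr0n/= gt_min.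
    by rewrite invf_lt1 ?ltr1n ?orbT.
  have /cvg_lim lim_e' := @cvg_einfs_sup R (F e').
  rewrite limn_einf_lim lim_e'//.
  move=> /ereal_sup_gt[_ [N _ <-] cN]; exists N => // n /= Nn.
  rewrite (le_trans _ (ndF e' e n _)) ?ge_min ?lexx// (le_trans (ltW cN))//.
  by apply: ereal_inf_lbound; exists n.
apply: (@lt_le_trans _ _ c%:E); first by rewrite lte_fin.
apply: le_ereal_inf_tmp => _ [e + <-].
rewrite /= in_itv/= => /andP[e0 _].
rewrite limn_einf_lim; apply: lime_ge; first exact: is_cvg_einfs.
have [N _ cN] := cF e e0; exists N => // n /= Nn.
apply: le_ereal_inf_tmp => _ [m nm <-]; apply: cN => /=.
exact: leq_trans nm.
Qed.

(** * Densities and truncation of generalized couplings *)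

Section density_bounds.
Context d (T : measurableType d) (R : realType).
Variables nu mu : probability T R.
Hypothesis nu_mu : nu `<< mu.
Local Notation u := (density nu mu).

Lemma density_integrable : mu.-integrable setT u.
Proof. exact: Radon_Nikodym_integrable. Qed.

Lemma measurable_density : measurable_fun setT u.
Proof. exact: measurable_int density_integrable. Qed.

Lemma density_integral A : measurable A -> nu A = \int[mu]_(x in A) u x.
Proof. by move=> mA; rewrite -Radon_Nikodym_integral. Qed.

Lemma measurable_density_le (K : R) : measurable [set x | u x <= K%:E].
Proof.
by rewrite -[X in measurable X]setTI; apply: emeasurable_fun_infty_c => //;
  exact: measurable_density.
Qed.

Lemma measurable_density_gt (K : R) : measurable [set x | K%:E < u x].
Proof.
by rewrite -[X in measurable X]setTI; apply: emeasurable_fun_o_infty => //;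
  exact: measurable_density.
Qed.

Lemma measure_density_le (K : R) A : measurable A ->
  nu (A `&` [set x | u x <= K%:E]) <= K%:E * mu (A `&` [set x | u x <= K%:E]).
Proof.
move=> mA; have mAK := measurableI _ _ mA (measurable_density_le K).
rewrite density_integral// -integral_cst//.
apply: le_integral => //.
- exact: integrableS density_integrable.
- exact: finite_measure_integrable_cst.
- by move=> x; rewrite inE => -[_].
Qed.

Lemma measure_density_gt_Lnorm (K p r : R) : (0 < K)%R -> (1 < p)%R ->
  'N[mu]_(p%:E)[u] <= r%:E ->
  nu [set x | K%:E < u x] <= (K `^ (1 - p) * r `^ p)%:E.
Proof.
move=> K0 p1 Nr; have p0 : p != 0%R by rewrite gt_eqF// (lt_trans _ p1).
have mK := measurable_density_gt K.
have mup : measurable_fun setT (fun x => `|u x| `^ p).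
  apply: (measurableT_comp (measurable_poweR p)).
  by apply: measurableT_comp => //; exact: measurable_density.
apply: (@le_trans _ _ (\int[mu]_x ((K `^ (1 - p))%:E * `|u x| `^ p))).
  rewrite density_integral//.
  apply: (@le_trans _ _ (\int[mu]_(x in [set x | K%:E < u x])
      ((K `^ (1 - p))%:E * `|u x| `^ p))).
    apply: ge0_le_integral => //.
    - by move=> x /= Ku; rewrite (le_trans _ (ltW Ku))// lee_fin ltW.
    - exact: measurable_funS measurable_density.
    - by apply: measurable_funS (measurable_funeM _ mup).
    move=> x /= Ku; have ufin : u x \is a fin_num by exact: Radon_Nikodym_fin_num.
    move: Ku; rewrite -(fineK ufin); set y := fine _; rewrite lte_fin => Ky.
    have y0 : (0 < y)%R by exact: lt_trans Ky.
    rewrite [`|_|](_ : _ = y%:E) ?poweR_EFin; last by rewrite /= gtr0_norm.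
    have yE : y = (y `^ (1 - p) * y `^ p)%R.
      by rewrite -powRD subrK ?powRr1 ?oner_eq0 ?ltW.
    rewrite -EFinM lee_fin [leLHS]yE.
    rewrite ler_wpM2r ?powR_ge0// -[(1 - p)%R]opprB !powRN lef_pV2 ?posrE ?powR_gt0//.
    by apply: ge0_ler_powR; rewrite ?nnegrE ?subr_ge0 ltW.
  apply: ge0_subset_integral => //; first exact: measurable_funeM.
  by move=> x _; apply: mule_ge0; rewrite ?lee_fin ?powR_ge0 ?poweR_ge0.
rewrite ge0_integralZl_EFin//; last 2 first.
- by move=> x _; exact: poweR_ge0.
- exact: powR_ge0.
rewrite -powR_Lnorm// EFinM lee_wpmul2l// ?lee_fin ?powR_ge0//.
rewrite -poweR_EFin; apply: gt0_ler_poweR => //; first by rewrite ltW// (lt_trans _ p1).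
- by rewrite in_itv/= Lnorm_ge0 leey.
- by rewrite in_itv/= leey andbT (le_trans _ Nr)// Lnorm_ge0.
Qed.

(** The density is finite everywhere, so the sets where it exceeds [n.+1] decrease to the empty set.
    Here [K] depends on [nu], which is enough for a single generalized coupling. *)
Lemma measure_density_gt_small (e : R) : (0 < e)%R ->
  exists2 K : R, (0 < K)%R & nu [set x | K%:E < u x] <= e%:E.
Proof.
move=> e0; pose F n := [set x | n.+1%:R%:E < u x].
have F0 : \bigcap_n F n = set0.
  rewrite -subset0 => x Fx; have ufin : u x \is a fin_num.
    exact: Radon_Nikodym_fin_num.
  have := Fx (Num.truncn (fine (u x))) I; rewrite /F /= -{2}(fineK ufin) lte_fin.
  by apply/negP; rewrite -leNgt ltW// truncnS_gt.
have [||N FN] := @nonincreasing_measure_small _ _ _ nu F e _ _ F0 e0.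
- by move=> n; exact: measurable_density_gt.
- by move=> m n mn x; apply: le_lt_trans; rewrite lee_fin ler_nat.
by exists N.+1%:R.
Qed.

End density_bounds.

Lemma density_self_Lnorm d (T : measurableType d) (R : realType)
    (nu mu : probability T R) (p : R) : (p != 0)%R ->
  (forall A, measurable A -> nu A = mu A) ->
  nu `<< mu /\ 'N[mu]_(p%:E)[density nu mu] = 1.
Proof.
move=> p0 nuE; have nu_mu : nu `<< mu.
  by apply/null_content_dominatesP => A mA; rewrite nuE.
split=> //.
have ae1 : ae_eq mu setT (density nu mu) (cst 1).
  apply: integral_ae_eq => //; first exact: density_integrable.
  by move=> A _ mA; rewrite integral_cst// mul1e -density_integral// nuE.
have <- : 'N[mu]_(p%:E)[cst 1] = 1.
  rewrite Lnorm_cst1 -[RHS](@poweR1r _ p^-1); congr (_ `^ _).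
  exact: probability_setT.
rewrite unlock; congr (_ `^ _).
apply: ge0_ae_eq_integral => //.
- apply: (measurableT_comp (measurable_poweR p)).
  by apply: measurableT_comp => //; exact: measurable_density.
- by move=> x _; exact: poweR_ge0.
- by move=> x _; exact: poweR_ge0.
- exact: (ae_eq_comp (fun z => `|z| `^ p)).
Qed.

Section gcouplings.
Context d (T : measurableType d) (R : realType).
Implicit Types mu nu : probability T R.

(* Restrict [xi] to the rectangle where both densities are at most [K]: divided
   by [K] it has marginals below [mu] and [nu]. *)
Lemma gcoupling_truncate mu nu xi (K : R) : (0 < K)%R -> gcouplings mu nu xi ->
  exists2 eta, couplings mu nu eta & forall C, measurable C ->
    xi C <= K%:E * eta C +
            (marginal1 xi [set x | K%:E < density (marginal1 xi) mu x] +
             marginal2 xi [set x | K%:E < density (marginal2 xi) nu x]).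
Proof.
move=> K0 [dom1 dom2].
set U1 := [set x | K%:E < density (marginal1 xi) mu x].
set U2 := [set x | K%:E < density (marginal2 xi) nu x].
pose S1 := [set x | density (marginal1 xi) mu x <= K%:E].
pose S2 := [set x | density (marginal2 xi) nu x <= K%:E].
have mS1 : measurable S1 by exact: measurable_density_le.
have mS2 : measurable S2 by exact: measurable_density_le.
have mU1 : measurable U1 by exact: measurable_density_gt.
have mU2 : measurable U2 by exact: measurable_density_gt.
have mS : measurable (S1 `*` S2) by exact: measurableX.
have Ki0 : (0 <= K^-1)%R by rewrite invr_ge0 ltW.
pose m : {measure set (T * T) -> \bar R} :=
  mscale (NngNum Ki0) (mrestr xi mS).
have mE A : m A = K^-1%:E * xi (A `&` (S1 `*` S2)) by [].
have KK x y : x <= K%:E * y -> K^-1%:E * x <= y.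
  move=> xy; rewrite -[leRHS]mul1e -(@mulVf _ K) ?gt_eqF// EFinM -muleA.
  by rewrite lee_wpmul2l// lee_fin.
have [A mA|A mA|eta Ceta le_eta] := @subcoupling_extend _ _ _ mu nu m.
- rewrite mE; apply: KK; apply: (@le_trans _ _ (K%:E * mu (A `&` S1))); last first.
    rewrite lee_wpmul2l ?lee_fin ?(ltW K0)//.
    by apply: measure_subset => //; exact: measurableI.
  apply: le_trans (measure_density_le dom1 K mA).
  rewrite /distribution /pushforward; apply: measure_subset.
  + by apply: measurableI => //; exact: measurableX.
  + by rewrite -[X in measurable X]setTI; apply: measurable_fst => //; exact: measurableI.
  + by move=> z [[Az _] [S1z _]].
- rewrite mE; apply: KK; apply: (@le_trans _ _ (K%:E * nu (A `&` S2))); last first.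
    rewrite lee_wpmul2l ?lee_fin ?(ltW K0)//.
    by apply: measure_subset => //; exact: measurableI.
  apply: le_trans (measure_density_le dom2 K mA).
  rewrite /distribution /pushforward; apply: measure_subset.
  + by apply: measurableI => //; exact: measurableX.
  + by rewrite -[X in measurable X]setTI; apply: measurable_snd => //; exact: measurableI.
  + by move=> z [[_ Az] [_ S2z]].
exists eta => // C mC.
have mfU1 : measurable (fst @^-1` U1 : set (T * T)) by rewrite -setXT; exact: measurableX.
have mfU2 : measurable (snd @^-1` U2 : set (T * T)) by rewrite -setTX; exact: measurableX.
(* Off the rectangle one of the coordinates has a density above [K]; the two strips so obtained have
   as [xi]-measures exactly the tails of the marginals. *)
apply: (@le_trans _ _ (xi ((C `&` (S1 `*` S2)) `|` (fst @^-1` U1 `|` snd @^-1` U2)))).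
  apply: measure_subset => //.
    by apply: measurableU; [exact: measurableI|exact: measurableU].
  move=> z Cz; have [z1|z1] := leP (density (marginal1 xi) mu z.1) K%:E; last by right; left.
  have [z2|z2] := leP (density (marginal2 xi) nu z.2) K%:E; last by right; right.
  by left.
apply: le_trans (measureU2 _ _ _) _; [exact: measurableI|exact: measurableU|].
apply: leeD; last exact: le_trans (measureU2 _ _ _) _.
have := le_eta _ mC; rewrite mE -(@lee_pmul2l _ K%:E)// muleA -EFinM mulfV ?gt_eqF//.
by rewrite mul1e.
Qed.

(** The densities of the marginals of a coupling equal 1 almost everywhere, so their norms are 1 for
    every exponent. *)
Lemma couplings_gcouplings_bounded mu nu (p r : R) : (p != 0)%R -> (1 <= r)%R ->
  couplings mu nu `<=` gcouplings_bounded p r mu nu.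
Proof.
move=> p0 r1 xi Cxi.
have [d1 n1] : marginal1 xi `<< mu /\ 'N[mu]_(p%:E)[density (marginal1 xi) mu] = 1.
  by apply: density_self_Lnorm => // A mA; have [] := Cxi _ mA.
have [d2 n2] : marginal2 xi `<< nu /\ 'N[nu]_(p%:E)[density (marginal2 xi) nu] = 1.
  by apply: density_self_Lnorm => // A mA; have [] := Cxi _ mA.
by split=> //; rewrite ?n1 ?n2 lee_fin.
Qed.

End gcouplings.

(** * Comparison of conditions (i), (ii) and (iii) *)

Section path_conditions.
Context dE (E : measurableType dE) (R : realType) (d : metric_fun R E).
Hypothesis md : measurable_fun [set: E * E] (fun z => d z.1 z.2).

Lemma measurable_coord n : measurable_fun [set: paths E] (fun w => w n).
Proof.
move=> _ B mB; rewrite setTI; apply: sub_sigma_algebra.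
by exists n => //; exists B.
Qed.

Lemma measurable_close_event e n : measurable (close_event d e n).
Proof.
have mn : measurable_fun [set: paths E * paths E] (fun w => (w.1 n, w.2 n)).
  apply/measurable_fun_pairP; split.
  - exact: measurableT_comp (measurable_coord n) measurable_fst.
  - exact: measurableT_comp (measurable_coord n) measurable_snd.
have -> : close_event d e n =
    (fun w => d (w.1 n) (w.2 n)) @^-1` [set` `]-oo, e]].
  by apply/seteqP; split=> w; rewrite /close_event /= in_itv.
rewrite -[X in measurable X]setTI.
exact: (measurableT_comp md mn).
Qed.

Lemma close_event_le e e' n : (e <= e')%R ->
  close_event d e n `<=` close_event d e' n.
Proof. by move=> ee' w /= /le_trans; exact. Qed.

Variables Q1 Q2 : probability (paths E) R.

(** Giving up half of the constant replaces the supremum by an actual member of [C], which may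
    depend on both [e] and [n]. *)
Lemma sup_close_gt0 (C : set (probability (paths E * paths E)%type R)) :
  0 < lim_liminf (fun e n => ereal_sup [set xi (close_event d e n) | xi in C]) <->
  exists2 c : R, (0 < c)%R & forall e, (0 < e)%R ->
    \forall n \near \oo, exists2 xi, C xi & c%:E <= xi (close_event d e n).
Proof.
have nd (e e' : R) n : (e <= e')%R ->
    ereal_sup [set xi (close_event d e n) | xi in C] <=
    ereal_sup [set xi (close_event d e' n) | xi in C].
  move=> ee'; apply: ge_ereal_sup => _ [xi Cxi <-].
  apply: (@le_trans _ _ (xi (close_event d e' n))); last first.
    by apply: ereal_sup_ubound; exists xi.
  by apply: measure_subset; [exact: measurable_close_event..|exact: close_event_le].
apply: (iff_trans (lim_liminf_gt0 nd)); split=> -[c c0 cF].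
  exists (c / 2)%R; first by rewrite divr_gt0.
  move=> e e0; apply: filterS (cF e e0) => n c_sup.
  have /ereal_sup_gt[_ [xi Cxi <-] /ltW] : (c / 2)%:E <
      ereal_sup [set xi (close_event d e n) | xi in C].
    by apply: lt_le_trans c_sup; rewrite lte_fin; lra.
  by exists xi.
exists c => // e e0; apply: filterS (cF e e0) => n [xi Cxi] /le_trans; apply.
by apply: ereal_sup_ubound; exists xi.
Qed.

(** The common core of (ii) and (iii): all that matters is that the density tails are small
    uniformly over [C]. *)
Lemma gcouplings_cond_i (C : set (probability (paths E * paths E)%type R)) :
  C `<=` gcouplings Q1 Q2 ->
  (forall a : R, (0 < a)%R -> exists2 K : R, (0 < K)%R & forall xi, C xi ->
    marginal1 xi [set x | K%:E < density (marginal1 xi) Q1 x] <= a%:E /\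
    marginal2 xi [set x | K%:E < density (marginal2 xi) Q2 x] <= a%:E) ->
  0 < lim_liminf (fun e n => ereal_sup [set xi (close_event d e n) | xi in C]) ->
  cond_i d Q1 Q2.
Proof.
move=> CG tailC /sup_close_gt0[c c0 cC]; apply/sup_close_gt0.
(* Two tails of [c / 4] leave half of the mass [c], and the truncation divides it by [K]. *)
have c4 : (0 < c / 4)%R by rewrite divr_gt0.
have [K K0 tailK] := tailC _ c4.
exists (c / (2 * K))%R; first by rewrite divr_gt0// mulr_gt0.
move=> e e0; apply: filterS (cC e e0) => n [xi Cxi cxi].
have [t1 t2] := tailK _ Cxi.
have [eta Ceta xi_eta] := gcoupling_truncate K0 (CG _ Cxi).
exists eta => //; have /xi_eta := measurable_close_event e n.
move=> /(le_trans cxi)/le_trans/(_ (leeD2l _ (leeD t1 t2))).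
rewrite -[eta _]fineK ?fin_num_measure//; last exact: measurable_close_event.
rewrite -!EFinM -!EFinD !lee_fin => h.
rewrite invfM mulrA ler_pdivrMr// mulrC; lra.
Qed.

Lemma cond_i_iff_ii : cond_i d Q1 Q2 <-> cond_ii d Q1 Q2.
Proof.
split=> [/sup_close_gt0[c c0 cC]|[p [r [p1 r1]]]].
  exists 2%R, 1%R; split=> //; first by rewrite ltr1n.
  apply/sup_close_gt0; exists c => // e e0.
  apply: filterS (cC e e0) => n [xi Cxi cxi]; exists xi => //.
  exact: couplings_gcouplings_bounded Cxi.
apply: gcouplings_cond_i => [xi []//|a a0].
have rp0 : (0 < r `^ p)%R by rewrite powR_gt0// (lt_le_trans _ r1).
(* The solution of [K^(1-p) * r^p = a], which makes the tail bound equal to [a]. *)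
pose K := ((a / r `^ p) `^ (1 - p)^-1)%R.
have K0 : (0 < K)%R by rewrite powR_gt0// divr_gt0.
have KE : (K `^ (1 - p) * r `^ p = a)%R.
  rewrite -powRrM mulVf; last by rewrite subr_eq0 lt_eqF.
  by rewrite powRr1 ?divfK ?gt_eqF// ltW// divr_gt0.
exists K => // xi [[dom1 dom2] n1 n2]; rewrite -KE.
by split; apply: measure_density_gt_Lnorm.
Qed.

Lemma cond_iii_i : cond_iii d Q1 Q2 -> cond_i d Q1 Q2.
Proof.
move=> /ereal_sup_gt[_ [xi Gxi <-] xi_gt0].
(* In (iii) the measure [xi] is chosen before the limits, so a singleton class suffices and [K] may
   depend on [xi]. *)
apply: (@gcouplings_cond_i [set xi]) => [_ -> //|a a0|]; last first.
  by under eq_fun do under eq_fun do rewrite image_set1 ereal_sup1.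
have [dom1 dom2] := Gxi.
have [K1 K10 t1] := measure_density_gt_small dom1 a0.
have [K2 K20 t2] := measure_density_gt_small dom2 a0.
exists (Num.max K1 K2) => [|_ ->]; first by rewrite lt_max K10.
split.
- apply: le_trans t1; apply: measure_subset; [exact: measurable_density_gt..|].
  by move=> x; apply: le_lt_trans; rewrite lee_fin le_max lexx.
- apply: le_trans t2; apply: measure_subset; [exact: measurable_density_gt..|].
  by move=> x; apply: le_lt_trans; rewrite lee_fin le_max lexx orbT.
Qed.

End path_conditions.

(** * Two metrics with the same Borel sets *)

Section mspace_topology.
Context (R : realType) (T : choiceType).
Implicit Types d rho : metric_fun R T.

Lemma metric_ge0 d x y : (0 <= d x y)%R.
Proof.
have := metric_tri d y x x; rewrite metric_xx (metric_symm d y x); lra.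
Qed.

Lemma metric_dist_le d x y z : (`|d x z - d y z| <= d x y)%R.
Proof.
have := metric_tri d x y z; have := metric_tri d y x z.
rewrite (metric_symm d y x) ler_norml => h1 h2.
by apply/andP; split; lra.
Qed.

Lemma mspace_ballE d (x : mspace d) e : ball x e = [set y | (d x y < e)%R].
Proof. by rewrite ballEmdist. Qed.

Lemma mspace_openP d (A : set T) : open (A : set (mspace d)) <->
  forall x, A x -> exists2 e : R, (0 < e)%R & forall y, (d x y < e)%R -> A y.
Proof.
rewrite openE; split => [oA x Ax|Ad x /Ad[e e0 eA]].
  have /nbhs_ballP[e /= e0 eA] : nbhs (x : mspace d) A by exact: oA.
  by exists e => // y dxy; apply: eA; rewrite mspace_ballE.
by apply/nbhs_ballP; exists e => // y; rewrite (@mspace_ballE d x); exact: eA.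
Qed.

Lemma open_metric_lt d (x : T) r : open ([set y | (d y x < r)%R] : set (mspace d)).
Proof.
apply/mspace_openP => y /= yr; exists (r - d y x)%R; first by rewrite subr_gt0.
by move=> z yz; have := metric_tri d y z x; rewrite (metric_symm d z y); lra.
Qed.

Lemma continuous_metric_open rho d :
  continuous (fun z : (mspace rho * mspace rho)%type => d z.1 z.2 : R) ->
  forall A : set T, open (A : set (mspace d)) -> open (A : set (mspace rho)).
Proof.
move=> cd A /mspace_openP dA; apply/mspace_openP => x /dA[e e0 eA].
have /= /cvgrPdist_lt/(_ e e0) := cd (x, x).
rewrite metric_xx => -[[B C] /= [xB xC] BC].
move/nbhs_ballP: xC => [r r0 rC]; exists r => // y xy; apply: eA.
have /= := BC (x, y); rewrite sub0r normrN ger0_norm ?metric_ge0//; apply.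
split; first exact: nbhs_singleton xB.
by apply: rC; rewrite (@mspace_ballE rho x).
Qed.

Lemma dense_sequence rho d (x0 : T) :
  (forall A : set T, open (A : set (mspace d)) -> open (A : set (mspace rho))) ->
  separable (mspace rho) ->
  exists s : nat -> T, forall x e, (0 < e)%R -> exists n, (d x (s n) < e)%R.
Proof.
move=> d_rho [S /countable_injP[f f_inj] dS].
(* The sequence inverts the injection [f] of the dense set into [nat], with [x0] at the numbers that
   are not attained. *)
exists (fun n => xget x0 [set x | S x /\ f x = n]) => x e e0.
have [||y [/= xy Sy]] := dS [set y | (d y x < e)%R].
- by exists x; rewrite /= metric_xx.
- exact/d_rho/open_metric_lt.
exists (f y); case: xgetP => [z _ [Sz fzy]|/(_ y)/=]; last first.
  by move=> nSy; exfalso; exact: nSy.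
by rewrite (f_inj z y) ?inE// metric_symm.
Qed.

End mspace_topology.

Section borel_metric.
Context dE (E : measurableType dE) (R : realType).
Implicit Types (d rho : metric_fun R E).

Lemma measurable_fun_lt (D : set E) (f : E -> R) : measurable D ->
  (forall r, measurable [set x | (f x < r)%R]) -> measurable_fun D f.
Proof.
move=> mD mf; apply: (measurability _ (RGenInftyO.measurableE R)) => //.
move=> _ [_ [r ->] <-]; apply: measurableI => //.
rewrite (_ : _ @^-1` _ = [set x | (f x < r)%R])//.
Qed.

Lemma measurable_open d (A : set E) : @measurable dE E = <<s @open (mspace d) >> ->
  open (A : set (mspace d)) -> measurable A.
Proof. by move=> -> oA; exact: sub_sigma_algebra. Qed.

Lemma measurable_lipschitz d (h : E -> R) (L : R) :
  @measurable dE E = <<s @open (mspace d) >> ->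
  (forall x y, `|h x - h y| <= L * d x y)%R -> measurable_fun setT h.
Proof.
move=> mE hL; apply: measurable_fun_lt => // r; apply: (measurable_open mE).
(* [L] may be zero or negative, and the radius found below divides by the constant. *)
have [L' L'0 hL'] : exists2 L' : R, (0 < L')%R &
    forall x y, (`|h x - h y| <= L' * d x y)%R.
  exists (`|L| + 1)%R => [|x y]; first by rewrite ltr_wpDl.
  by rewrite (le_trans (hL x y))// ler_wpM2r ?metric_ge0// (le_trans (ler_norm _))// lerDl.
apply/mspace_openP => x /= hxr; exists ((r - h x) / L')%R.
  by rewrite divr_gt0// subr_gt0.
move=> y; rewrite ltr_pdivlMr// mulrC => dxy.
have := hL' y x; rewrite metric_symm ler_norml => /andP[_]; lra.
Qed.

(** Measurability is for the product sigma-algebra, so continuity alone does not give it: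
    [d x y < r] is written as a countable union of rectangles, through a point of the dense sequence
    near [y] and a rational between the two distances. *)
Lemma measurable_metric d (s : nat -> E) :
  @measurable dE E = <<s @open (mspace d) >> ->
  (forall x e, (0 < e)%R -> exists n, (d x (s n) < e)%R) ->
  measurable_fun [set: E * E] (fun z => d z.1 z.2).
Proof.
move=> mE sd.
have mlt n q : measurable [set x | (d x (s n) < q)%R].
  exact/(measurable_open mE)/open_metric_lt.
apply: (measurability _ (RGenInftyO.measurableE R)) => //.
move=> _ [_ [r ->] <-]; rewrite setTI.
have -> : (fun z : E * E => d z.1 z.2) @^-1` `]-oo, r[ =
    \bigcup_(p : nat * rat) ([set x | (d x (s p.1) < ratr p.2)%R] `*`
                      [set y | (d y (s p.1) < r - ratr p.2)%R]).
  apply/seteqP; split => [[x y]|[x y] [[n q] _ /= [xq yq]]] /=; rewrite in_itv/=.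
    move=> xyr; have e0 : (0 < (r - d x y) / 2)%R by lra.
    have [n yn] := sd y _ e0.
    have [q /andP[xq qr]] : exists q, (d x (s n) < ratr q < r - d y (s n))%R.
      have : (d x (s n) < r - d y (s n))%R.
        by have := metric_tri d y x (s n); lra.
      by move=> /rat_in_itvoo[q]; rewrite in_itv/=; exists q.
    by exists (n, q) => //=; split => /=; lra.
  by have := metric_tri d (s n) x y; rewrite (metric_symm d (s n) y); lra.
apply: countable_bigcupT_measurable => // -[n q].
by apply: measurableX; exact: mlt.
Qed.

End borel_metric.

(** On [E] each [rho x y] is, as a function of [x], a pointwise limit of [d]-continuous functions,
    so [rho]-balls are [d]-Borel. By separability every [rho]-open set is a countable union of such
    balls. *)
Lemma completion_approx_measurable (R : realType) dE (E : measurableType dE)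
    (rho d : metric_fun R E) (Ebar : metricType R) (iota : mspace d -> Ebar)
    (s : nat -> E) :
  (forall x y, mdist (iota x) (iota y) = mdist x y) ->
  completion_approx rho iota ->
  @measurable dE E = <<s @open (mspace rho) >> ->
  (forall A : set E, open (A : set (mspace d)) -> open (A : set (mspace rho))) ->
  (forall x e, (0 < e)%R -> exists n, (rho x (s n) < e)%R) ->
  @measurable dE E = <<s @open (mspace d) >>.
Proof.
move=> iso_iota rho_lim mE d_rho s_dense; apply/seteqP; split; last first.
  rewrite mE; apply: smallest_sub; first exact: smallest_sigma_algebra.
  by move=> B oB; apply: sub_sigma_algebra; exact: d_rho.
rewrite mE; apply: smallest_sub; first exact: smallest_sigma_algebra.
have mlt y r : <<s @open (mspace d) >> [set x | (rho x y < r)%R].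
  pose Ed := g_sigma_algebraType (@open (mspace d)).
  have [f [f_cont _ f_lim _]] := rho_lim y.
  suff : measurable_fun [set: Ed] (fun x : Ed => rho x y).
    move=> /(_ measurableT `]-oo, r[%classic); rewrite setTI.
    rewrite (_ : _ @^-1` _ = [set x | (rho x y < r)%R]); last first.
      by apply/seteqP; split=> x; rewrite /= in_itv.
    by apply; exact: measurable_itv.
  apply: (@measurable_fun_cvg _ _ _ _ (fun n (x : Ed) => f n (iota x))); last first.
    by move=> x _; exact: f_lim.
  move=> n; apply: measurable_fun_lt => // q.
  apply: sub_sigma_algebra.
  apply/mspace_openP => x /= fxq.
  have /nbhs_ballP[e /= e0 eq] : nbhs (iota x) [set z | (f n z < q)%R].
    exact: (f_cont n (iota x) _ (lt_nbhsl fxq)).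
  exists e => // z xz; apply: (eq (iota z)).
  by rewrite ballEmdist /= iso_iota.
move=> A /mspace_openP oA.
pose D : set (nat * rat) :=
  [set p | [set x | (rho x (s p.1) < ratr p.2)%R] `<=` A].
have -> : A = \bigcup_(p in D) [set x | (rho x (s p.1) < ratr p.2)%R].
  apply/seteqP; split => [x Ax|x [p Dp]]; last exact: Dp.
  have [e e0 eA] := oA x Ax; have e20 : (0 < e / 2)%R by rewrite divr_gt0.
  have [n xn] := s_dense x _ e20.
  have [q /[!in_itv]/= /andP[q1 q2]] := rat_in_itvoo xn.
  exists (n, q) => //= y /= yn; apply: eA.
  have := metric_tri rho (s n) x y; rewrite (metric_symm rho (s n) y); lra.
rewrite bigcup_mkcond.
apply: (@countable_bigcupT_measurable _ (g_sigma_algebraType (@open (mspace d)))).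
  exact: countableP.
by move=> p; case: ifP => _; [exact: mlt|exact: measurable0].
Qed.

(** * Density of Lipschitz functions in mean *)

Section lipschitz_density.
Context (R : realType) dE (E : measurableType dE) (d : metric_fun R E).
Hypothesis mE : @measurable dE E = <<s @open (mspace d) >>.
Variable mu : probability E R.
Implicit Types f g : E -> R.

(** The closure of the Lipschitz functions in [L^1(mu)]; measurability of [h] comes from its
    Lipschitz bound. *)
Definition lipschitz_approx (f : E -> R) : Prop :=
  measurable_fun setT f /\
  forall eta : R, (0 < eta)%R -> exists h : E -> R, exists2 L : R,
    (forall x y, `|h x - h y| <= L * d x y)%R &
    \int[mu]_x `|f x - h x|%:E <= eta%:E.

Lemma lipschitz_approx_closed f : measurable_fun setT f ->
  (forall eta : R, (0 < eta)%R -> exists2 g, lipschitz_approx g &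
     \int[mu]_x `|f x - g x|%:E <= eta%:E) ->
  lipschitz_approx f.
Proof.
move=> mf f_lim; split=> // eta eta0.
have e0 : (0 < eta / 2)%R by rewrite divr_gt0.
have [g [mg /(_ _ e0)[h [L hL gh]]] fg] := f_lim _ e0.
have mh := measurable_lipschitz mE hL.
exists h, L => //; rewrite (splitr eta) EFinD.
apply: le_trans (leeD fg gh); rewrite -ge0_integralD//.
- apply: ge0_le_integral => //.
  + by do 2 apply: measurableT_comp => //; exact: measurable_funB.
  + apply: emeasurable_funD; do 2 apply: measurableT_comp => //;
      exact: measurable_funB.
  + by move=> x _; rewrite -EFinD lee_fin ler_distD.
- by do 2 apply: measurableT_comp => //; exact: measurable_funB.
- by do 2 apply: measurableT_comp => //; exact: measurable_funB.
Qed.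

Lemma lipschitz_approxD f g :
  lipschitz_approx f -> lipschitz_approx g -> lipschitz_approx (f \+ g)%R.
Proof.
move=> [mf af] [mg ag]; split; first exact: measurable_funD.
move=> eta eta0; have e0 : (0 < eta / 2)%R by rewrite divr_gt0.
have [h [L hL fh]] := af _ e0; have [k [M kM gk]] := ag _ e0.
have mh := measurable_lipschitz mE hL; have mk := measurable_lipschitz mE kM.
exists (h \+ k)%R, (L + M)%R => [x y|] /=.
  rewrite mulrDl opprD addrACA (le_trans (ler_normD _ _))// lerD//.
rewrite (splitr eta) EFinD; apply: le_trans (leeD fh gk).
rewrite -ge0_integralD//.
- apply: ge0_le_integral => //.
  + by do 2 apply: measurableT_comp => //; apply: measurable_funB; exact: measurable_funD.
  + apply: emeasurable_funD; do 2 apply: measurableT_comp => //;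
      exact: measurable_funB.
  + by move=> x _; rewrite -EFinD lee_fin opprD addrACA ler_normD.
- by do 2 apply: measurableT_comp => //; exact: measurable_funB.
- by do 2 apply: measurableT_comp => //; exact: measurable_funB.
Qed.

Lemma lipschitz_approx_cst c : lipschitz_approx (cst c).
Proof.
split=> // eta eta0; exists (cst c), 0%R => [x y|]; first by rewrite subrr normr0 mul0r.
by rewrite integral0_eq ?lee_fin ?ltW// => x _; rewrite subrr normr0.
Qed.

Lemma lipschitz_approxZ c f : lipschitz_approx f ->
  lipschitz_approx (fun x => c * f x)%R.
Proof.
move=> [mf af]; split; first exact: measurable_funM.
move=> eta eta0; have e0 : (0 < eta / (`|c| + 1))%R.
  by rewrite divr_gt0// ltr_wpDl.
have [h [L hL fh]] := af _ e0; have mh := measurable_lipschitz mE hL.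
exists (fun x => c * h x)%R, (`|c| * L)%R => [x y|].
  by rewrite -mulrBr normrM -mulrA ler_wpM2l.
under eq_integral do rewrite -mulrBr normrM EFinM.
rewrite ge0_integralZl_EFin//; last first.
  by do 2 apply: measurableT_comp => //; exact: measurable_funB.
apply: (@le_trans _ _ (`|c|%:E * (eta / (`|c| + 1))%:E)).
  by rewrite lee_wpmul2l// lee_fin.
rewrite -EFinM lee_fin mulrA ler_pdivrMr ?ltr_wpDl// mulrC ler_pM2l//.
by rewrite lerDl.
Qed.

(** With [D] the distance to the complement, [min 1 (N.+1 * D)] differs from the indicator only
    where [0 < D < 1 / N.+1], and these sets decrease to the empty set. *)
Lemma lipschitz_approx_open (A : set E) : open (A : set (mspace d)) ->
  lipschitz_approx \1_A.
Proof.
move=> oA; have mA := measurable_open mE oA.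
(* For [A = setT] the infimum defining [D] would range over the empty set. *)
have [->|AN0] := eqVneq A setT; first by rewrite indicT; exact: lipschitz_approx_cst.
have [z0 Az0] : exists z, ~ A z.
  by apply/existsNP => AT; move/eqP: AN0; apply; rewrite -subTset => z _; exact: AT.
pose D x : R := inf [set d x z | z in ~` A].
have Dn0 x : [set d x z | z in ~` A] !=set0 by exists (d x z0); exists z0.
have Dlb x : has_lbound [set d x z | z in ~` A].
  by exists 0%R => _ [z _ <-]; exact: metric_ge0.
have D_le x y : (D x <= d x y + D y)%R.
  rewrite -lerBlDl; apply: lb_le_inf => // _ [z Az <-]; rewrite lerBlDl.
  by apply: le_trans (metric_tri d y x z); apply: ge_inf => //; exists z.
have DL x y : (`|D x - D y| <= d x y)%R.
  by rewrite ler_norml; have := D_le x y; have := D_le y x;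
    rewrite (metric_symm d y x) => *; apply/andP; split; lra.
have D0 x : (0 <= D x)%R.
  by apply: lb_le_inf => // _ [z _ <-]; exact: metric_ge0.
have DA x : A x <-> (0 < D x)%R.
  split => [Ax|Dx].
    have [e e0 eA] := (mspace_openP d A).1 oA x Ax.
    apply: (lt_le_trans e0); apply: lb_le_inf => // _ [z Az <-].
    by rewrite leNgt; apply/negP => /eA.
  apply: contrapT => Ax; move: Dx; rewrite ltNge => /negP; apply.
  by rewrite -(metric_xx d x); apply: ge_inf => //; exists x.
have mD : measurable_fun setT D.
  by apply: (@measurable_lipschitz _ _ _ d _ 1%R mE) => x y; rewrite mul1r.
pose F n := [set x | 0 < D x < n.+1%:R^-1]%R.
have mF n : measurable (F n).
  have -> : F n = D @^-1` `]0%R, n.+1%:R^-1%R[.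
    by apply/seteqP; split=> x; rewrite /F /= in_itv.
  by rewrite -[X in measurable X]setTI; exact: mD.
split; first exact: measurable_indic.
move=> eta eta0.
have [||N FN] := @nonincreasing_measure_small _ _ _ mu F eta mF _ _ eta0.
- move=> m n mn x /andP[Dx xn]; apply/andP; split=> //; apply: (lt_le_trans xn).
  by rewrite lef_pV2 ?posrE ?ltr0n// ler_nat.
- rewrite -subset0 => x Fx.
  have /andP[Dx _] := Fx 0%N I.
  have := Fx (Num.truncn (D x)^-1) I => /andP[_]; apply/negP; rewrite -leNgt.
  rewrite -[leRHS]invrK lef_pV2 ?posrE ?ltr0n ?invr_gt0//.
  by rewrite ltW// truncnS_gt.
exists (fun x => Num.min 1 (N.+1%:R * D x))%R, N.+1%:R.
  move=> x y; apply: (@le_trans _ _ `|N.+1%:R * D x - N.+1%:R * D y|%R).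
    move: (N.+1%:R * D x)%R (N.+1%:R * D y)%R => a b.
    by rewrite ler_norml; case: (ger0P (a - b)%R); case: (leP 1%R a);
      case: (leP 1%R b) => *; apply/andP; split; lra.
  by rewrite -mulrBr normrM ger0_norm// ler_wpM2l.
apply: le_trans FN; apply: integral_le_measure => //.
- do 2 apply: measurableT_comp => //; apply: measurable_funB.
    exact: measurable_indic.
  by apply: measurable_minr => //; exact: measurable_funM.
move=> x; rewrite lee_fin !indicE.
have [Ax|Ax] := pselect (A x); last first.
  have Dx : D x = 0%R.
    by apply/eqP; rewrite eq_le D0 andbT leNgt; apply/negP => /DA.
  by rewrite memNset// Dx mulr0 min_r// subrr normr0.
have Dx := (DA x).1 Ax; have [le1D|lt1D] := leP 1%R (N.+1%:R * D x)%R.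
  by rewrite mem_set// subrr normr0.
have FNx : F N x by rewrite /F /= Dx -[ltRHS]mulr1 ltr_pdivlMl.
rewrite (mem_set Ax) (mem_set FNx).
have ND0 : (0 <= N.+1%:R * D x)%R by rewrite mulr_ge0.
by rewrite ger0_norm /=; lra.
Qed.

(** A Dynkin argument from the open sets, which are stable under intersection. Disjointness makes
    the indicator of a finite union a sum, and a countable union is an [L^1] limit of finite
    ones. *)
Lemma lipschitz_approx_indic (A : set E) : measurable A -> lipschitz_approx \1_A.
Proof.
move=> mA; suff indic_open : <<s @open (mspace d) >> `<=`
    (fun B : set E => lipschitz_approx \1_B) by apply: indic_open; rewrite -mE.
move=> {A mA}A; apply: (@dynkin_induction _ _ _ (fun B => lipschitz_approx \1_B) mE).
- by move=> B C; exact: openI.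
- by rewrite indicT; exact: lipschitz_approx_cst.
- exact: lipschitz_approx_open.
- move=> {}A mA lA.
  have -> : \1_(~` A) = (cst 1 \+ (fun x => -1 * \1_A x) : E -> R)%R.
    by apply/funext => x /=; rewrite indicC indicE; case: (x \in A) => /=; ring.
  by apply: lipschitz_approxD; [exact: lipschitz_approx_cst|exact: lipschitz_approxZ].
- move=> F mF tF lF.
  have mUF : measurable (\bigcup_k F k) by exact: bigcupT_measurable.
  pose U n := \bigcup_(k < n) F k.
  have mU n : measurable (U n) by apply: bigcup_measurable => k _.
  have lU n : lipschitz_approx \1_(U n).
    elim: n => [|n IHn].
      by rewrite /U bigcup_mkord big_ord0 indic0; exact: (lipschitz_approx_cst 0%R).
    have -> : \1_(U n.+1) = (\1_(U n) \+ \1_(F n) : E -> R)%R.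
      apply/funext => x; rewrite /= !indicE.
      have UE : U n.+1 = U n `|` F n by rewrite /U !bigcup_mkord big_ord_recr.
      have [Fx|Fx] := pselect (F n x).
        have nUx : ~ U n x.
          move=> [k /= kn Fkx]; move/trivIsetP : tF => /(_ k n I I).
          by rewrite (ltn_eqF kn) => /(_ isT); rewrite -subset0 => /(_ x); exact.
        by rewrite UE (memNset nUx) !mem_set ?add0r//; right.
      rewrite UE (memNset Fx) addr0; congr (nat_of_bool _)%:R.
      by apply/idP/idP; rewrite !inE; [case|left].
    exact: lipschitz_approxD.
  apply: lipschitz_approx_closed; first exact: measurable_indic.
  move=> eta eta0.
  have [|||n Fn] := @nonincreasing_measure_small _ _ _ mu
    (fun n => \bigcup_k F k `\` U n) eta _ _ _ eta0.
  + by move=> n; exact: measurableD.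
  + move=> m n mn x [Fx Ux]; split=> // -[k /= km Fkx]; apply: Ux.
    by exists k => //=; exact: leq_trans mn.
  + by rewrite -subset0 => x FUx; have [[k _ Fkx] _] := FUx 0%N I;
      have [_] := FUx k.+1 I; apply; exists k => /=.
  exists (\1_(U n)) => //; apply: le_trans Fn; apply: integral_le_measure => //.
  + exact: measurableD.
  + by do 2 apply: measurableT_comp => //; apply: measurable_funB;
      exact: measurable_indic.
  move=> x; rewrite lee_fin !indicE.
  have [Ux|Ux] := pselect (U n x).
    have Fx : (\bigcup_k F k) x by case: Ux => k _ Fkx; exists k.
    by rewrite (mem_set Fx) (mem_set Ux) subrr normr0.
  rewrite (memNset Ux) subr0 ger0_norm// ler_nat leq_eqVlt.
  apply/orP; left; apply/eqP; congr nat_of_bool.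
  by apply: asbool_equiv_eq; split=> [Fx|[]//]; split.
Qed.

Import HBSimple.

Lemma lipschitz_approx_bounded f (M : R) : measurable_fun setT f ->
  (forall x, `|f x| <= M)%R -> lipschitz_approx f.
Proof.
move=> mf fM.
have f_int : mu.-integrable setT (EFin \o f).
  apply: measurable_bounded_integrable => //.
    by rewrite -ge0_fin_numE// fin_num_measure.
  by exists M; split; [exact: num_real|move=> N MN x _; exact: le_trans (fM x) (ltW MN)].
have [g [g_int _ /fine_cvgP[g_fin] /cvgr0_norm_lt g_lim]] :=
  approximation_sfun_integrable measurableT f_int.
apply: lipschitz_approx_closed => // eta eta0.
have [N1 _ gN1] := g_fin; have [N2 _ gN2] := g_lim _ eta0.
pose N := maxn N1 N2; exists (g N).
  have -> : (g N : E -> R) =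
     (fun x => \sum_(r <- finmap.enum_fset (fset_set (range (g N)))) r * \1_(g N @^-1` [set r]) x)%R.
    by apply/funext => x; rewrite fimfunE fsbig_finite.
  elim: (finmap.enum_fset _) => [|r s IHs].
    under eq_fun do rewrite big_nil.
    exact: (lipschitz_approx_cst 0%R).
  under eq_fun do rewrite big_cons.
  apply: lipschitz_approxD => //; apply: lipschitz_approxZ.
  exact: lipschitz_approx_indic.
have := gN2 N (leq_maxr _ _) => /=.
rewrite -lte_fin => /ltW; apply: le_trans.
apply: le_trans (_ : (fine (\int[mu]_z `|(f z)%:E - (g N z)%:E|))%:E <= _).
  by rewrite fineK//; exact: (gN1 N (leq_maxl _ _)).
by rewrite lee_fin ler_norm.
Qed.

End lipschitz_density.

(** * Laws of the chain at fixed times *)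

Section coord.
Context dE (E : measurableType dE).

(** Named so that it can carry the measurable-function structure that [distribution] asks for. *)
Definition coord n (w : paths E) : E := w n.

HB.instance Definition _ n :=
  isMeasurableFun.Build _ _ _ _ (coord n) (@measurable_coord _ E n).

End coord.

Section chain.
Context dE (E : measurableType dE) (R : realType).
Variables (P : R.-pker E ~> E) (Pr : E -> probability (paths E) R).
Hypothesis Pr_law : forall x, markov_law P x (Pr x).

(** [nstep] is a bare set function; this image law has the same values on measurable sets and is a
    probability by construction. *)
Definition state_law n x : probability E R := distribution (Pr x) (coord n).

Lemma state_law0 x A : measurable A -> state_law 0 x A = \d_x A.
Proof. by move=> mA; rewrite -((Pr_law x).1 A mA). Qed.

Lemma state_lawS n x A : measurable A ->
  state_law n.+1 x A = \int[state_law n x]_y P y A.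
Proof.
move=> mA; rewrite ge0_integral_pushforward//; last exact: measurable_kernel.
rewrite preimage_setT -((Pr_law x).2 n setT A)//; first by rewrite setTI.
have [s0 sD _] := smallest_sigma_algebra setT (@cylinders _ E `I_n.+1).
have := sD _ s0; rewrite setD0; exact.
Qed.

Lemma measurable_state_law n A : measurable A ->
  measurable_fun [set: E] (state_law n ^~ A).
Proof.
elim: n => [|n IHn] in A * => mA.
  have -> : (fun x => state_law 0 x A) = (fun x => (\1_A x)%:E).
    by apply/funext => x; rewrite state_law0// diracE.
  by apply/measurable_EFinP; exact: measurable_indic.
have -> : (fun x => state_law n.+1 x A) = (fun x => \int[state_law n x]_y P y A).
  by apply/funext => x; exact: state_lawS.
by apply: measurable_fun_integral_kernel => //; exact: measurable_kernel.
Qed.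

Lemma state_lawD m n x A : measurable A ->
  state_law (m + n) x A = \int[state_law m x]_y state_law n y A.
Proof.
elim: n => [|n IHn] in A * => mA.
  rewrite addn0 (eq_integral (fun y => (\1_A y)%:E)).
    by rewrite integral_indic// setIT.
  by move=> y _; rewrite state_law0// diracE.
rewrite addnS state_lawS//.
rewrite (integral_mixture (fun B mB => measurable_state_law n mB) IHn)//.
  by apply: eq_integral => y _; rewrite state_lawS.
exact: measurable_kernel.
Qed.

Lemma integral_state_lawD m n x (f : E -> \bar R) :
  (forall y, 0 <= f y) -> measurable_fun setT f ->
  \int[state_law (m + n) x]_z f z =
  \int[state_law m x]_y \int[state_law n y]_z f z.
Proof.
apply: integral_mixture => A mA; first exact: measurable_state_law.
exact: state_lawD.
Qed.

Lemma state_law1 x A : measurable A -> state_law 1 x A = P x A.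
Proof.
move=> mA; rewrite state_lawS//; transitivity (\int[dirac x]_y P y A).
  by apply: eq_measure_integral => C mC _; exact: state_law0.
by rewrite integral_dirac ?diracT ?mul1e//; exact: measurable_kernel.
Qed.

(** [nstep] splits off the first step while the Markov property on paths splits off the last one;
    the Chapman-Kolmogorov identity reconciles them. *)
Lemma nstep_state_law n x A : measurable A -> nstep P n x A = state_law n x A.
Proof.
elim: n => [|n IHn] in x * => mA /=; first by rewrite state_law0.
rewrite -add1n state_lawD//.
under eq_integral do rewrite IHn//.
by apply: eq_measure_integral => B mB _; apply/esym; exact: state_law1.
Qed.

Variable mu : probability E R.
Hypothesis mu_inv : invariant_prob P mu.

Lemma invariant_state_law n A : measurable A ->
  mu A = \int[mu]_x state_law n x A.
Proof.
elim: n => [|n IHn] in A * => mA.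
  rewrite (eq_integral (fun y => (\1_A y)%:E)).
    by rewrite integral_indic// setIT.
  by move=> y _; rewrite state_law0// diracE.
rewrite mu_inv//.
rewrite (integral_mixture (fun B mB => measurable_state_law n mB) IHn)//.
  by apply: eq_integral => y _; rewrite state_lawS.
exact: measurable_kernel.
Qed.

Lemma integral_invariant_state_law n (f : E -> \bar R) :
  (forall y, 0 <= f y) -> measurable_fun setT f ->
  \int[mu]_z f z = \int[mu]_x \int[state_law n x]_z f z.
Proof.
apply: integral_mixture => A mA; first exact: measurable_state_law.
exact: invariant_state_law.
Qed.

End chain.

(** * Conditional variances of the transition probabilities *)

Lemma integral_sqr_sub_mean d (T : measurableType d) (R : realType)
    (k : probability T R) (g : T -> R) (q : R) :
  measurable_fun setT g -> (forall x, 0 <= g x)%R -> (0 <= q)%R ->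
  \int[k]_x (g x)%:E = q%:E ->
  \int[k]_x ((g x - q) ^+ 2)%:E + (q ^+ 2)%:E = \int[k]_x (g x ^+ 2)%:E.
Proof.
move=> mg g0 q0 gq.
have mgE : measurable_fun setT (EFin \o g) by exact/measurable_EFinP.
have mg2 : measurable_fun setT (fun x => (g x ^+ 2)%:E).
  exact/measurable_EFinP/measurable_funX.
have mgq : measurable_fun setT (fun x => ((g x - q) ^+ 2)%:E).
  by apply/measurable_EFinP/measurable_funX; exact: measurable_funB.
(* The square is expanded with all terms moved to the side where they are nonnegative, so that the
   integrals split without any integrability condition. *)
have : \int[k]_x (((g x - q) ^+ 2)%:E + (2 * q)%:E * (g x)%:E) =
       \int[k]_x ((g x ^+ 2)%:E + (q ^+ 2)%:E).
  by apply: eq_integral => x _; rewrite -EFinM -!EFinD; congr EFin; ring.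
rewrite ge0_integralD//=; last 3 first.
- by move=> x _; rewrite lee_fin sqr_ge0.
- by move=> x _; rewrite -EFinM lee_fin !mulr_ge0.
- exact: measurable_funeM.
rewrite ge0_integralZl_EFin//; last 2 first.
- by move=> x _; rewrite lee_fin.
- by rewrite mulr_ge0.
rewrite ge0_integralD//=; last 2 first.
- by move=> x _; rewrite lee_fin sqr_ge0.
- by move=> x _; rewrite lee_fin sqr_ge0.
rewrite integral_cst//= probability_setT mule1 gq -EFinM.
move: (\int[k]_x _) (\int[k]_x _) => [a| |] [b| |] //=; rewrite -?EFinD//.
by move=> [] /(congr1 (fun t => t - q ^+ 2)%R) h; congr EFin; lra.
Qed.

Section pair_convergence.
Context (R : realType) dE (E : measurableType dE) (d : metric_fun R E).
Hypothesis mE : @measurable dE E = <<s @open (mspace d) >>.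
Hypothesis md : measurable_fun [set: E * E] (fun z => d z.1 z.2).
Variables (P : R.-pker E ~> E) (Pr : E -> probability (paths E) R).
Hypothesis Pr_law : forall x, markov_law P x (Pr x).
Variable mu : probability E R.
Hypothesis mu_inv : invariant_prob P mu.
Variable A : set E.
Hypothesis mA : measurable A.

Local Notation L := (state_law Pr).
Implicit Types (h : E -> R) (n m : nat) (eta : R).

Definition hit n x : R := fine (L n x A).

Lemma hitE n x : (hit n x)%:E = L n x A.
Proof. by rewrite fineK// fin_num_measure. Qed.

Lemma hit_ge0 n x : (0 <= hit n x)%R.
Proof. by rewrite -lee_fin hitE. Qed.

Lemma hit_le1 n x : (hit n x <= 1)%R.
Proof. by rewrite -lee_fin hitE probability_le1. Qed.

Lemma measurable_hit n : measurable_fun setT (hit n).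
Proof.
by apply/measurable_EFinP; rewrite (_ : _ \o _ = (fun x => L n x A));
  [exact: (measurable_state_law Pr_law)|apply/funext => x; rewrite /= hitE].
Qed.

Lemma hitD m n x : \int[L m x]_y (hit n y)%:E = (hit (m + n) x)%:E.
Proof.
by rewrite hitE (state_lawD Pr_law)//; apply: eq_integral => y _; rewrite hitE.
Qed.

Let sqr_hit_meas n : measurable_fun setT (fun x => (hit n x ^+ 2)%:E).
Proof. exact/measurable_EFinP/measurable_funX/measurable_hit. Qed.

Let sqr_hit_ge0 n x : 0 <= (hit n x ^+ 2)%:E.
Proof. by rewrite lee_fin sqr_ge0. Qed.

Definition hit_var m n z : \bar R :=
  \int[L m z]_x ((hit n x - hit (m + n) z) ^+ 2)%:E.

Lemma hit_var_ge0 m n z : 0 <= hit_var m n z.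
Proof. by apply: integral_ge0 => x _; rewrite lee_fin sqr_ge0. Qed.

Lemma hit_varE m n z : hit_var m n z + (hit (m + n) z ^+ 2)%:E =
  \int[L m z]_x (hit n x ^+ 2)%:E.
Proof.
apply: integral_sqr_sub_mean; [exact: measurable_hit|exact: hit_ge0|exact: hit_ge0|].
exact: hitD.
Qed.

Lemma measurable_hit_var m n : measurable_fun setT (hit_var m n).
Proof.
(* In [hit_var] both the measure and the integrand depend on [z]; as a difference the two
   dependences separate. *)
rewrite (_ : hit_var m n = (fun z => \int[L m z]_x (hit n x ^+ 2)%:E -
    (hit (m + n) z ^+ 2)%:E)); last first.
  by apply/funext => z; rewrite -hit_varE addeK.
apply: emeasurable_funB => //.
apply: measurable_fun_integral_kernel => //.
exact: (measurable_state_law Pr_law).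
Qed.

(* The second moments of [hit n] decrease in [n], and their increments are the
   conditional variances. *)
Lemma integral_hit_var m n :
  \int[mu]_z hit_var m n z + \int[mu]_z (hit (m + n) z ^+ 2)%:E =
  \int[mu]_z (hit n z ^+ 2)%:E.
Proof.
rewrite [RHS](integral_invariant_state_law Pr_law mu_inv m)//.
rewrite -ge0_integralD//; last 2 first.
- by move=> z _; exact: hit_var_ge0.
- exact: measurable_hit_var.
by apply: eq_integral => z _; exact: hit_varE.
Qed.

Lemma integral_hit_var_small (e : R) : (0 < e)%R ->
  exists n, forall m, \int[mu]_z hit_var m n z <= e%:E.
Proof.
move=> e0; pose a n := \int[mu]_z (hit n z ^+ 2)%:E.
have a0 n : 0 <= a n by exact: integral_ge0.
have a1 n : a n <= 1.
  rewrite -(@probability_setT _ _ _ mu) -[leRHS]mul1e -integral_cst//.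
  apply: ge0_le_integral => // x _ /=.
  by rewrite lee_fin expr_le1// ?hit_ge0// hit_le1.
have afin n : a n \is a fin_num by rewrite ge0_fin_numE// (le_lt_trans (a1 n))// ltry.
have infa : ereal_inf (range a) \is a fin_num.
  rewrite ge0_fin_numE; last by apply: le_ereal_inf_tmp => _ [n _ <-].
  by apply: (@le_lt_trans _ _ (a 0%N)); [apply: ereal_inf_lbound; exists 0%N|rewrite -ge0_fin_numE].
(* Once [a n] is within [e] of the infimum of all second moments, no later one can be lower by more
   than [e]; this makes [n] independent of [m]. *)
have [_ [n _ <-] an] := lb_ereal_inf_adherent e0 infa.
exists n => m; have := integral_hit_var m n; rewrite -/(a n) -/(a (m + n)%N) => aE.
have : ereal_inf (range a) <= a (m + n)%N by apply: ereal_inf_lbound; exists (m + n)%N.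
move: an aE; rewrite -(fineK infa) -(fineK (afin n)) -(fineK (afin (m + n)%N)).
case: (\int[mu]_z _) => [v| |] //=; rewrite -!EFinD lte_fin !lee_fin.
by move=> h1 [h2] h3; lra.
Qed.

(** The terms with [eta] replace a standard deviation through [|t| <= eta + t^2 / eta]: the bound is
    linear in the variance and can be integrated in [z]. *)
Definition pair_bound (h : E -> R) (n m : nat) (eta : R) (z : E) : \bar R :=
  \int[L m z]_x `|hit n x - h x|%:E + (eta%:E + eta^-1%:E * hit_var m n z).

Lemma pair_bound_ge0 h n m eta z : (0 < eta)%R -> 0 <= pair_bound h n m eta z.
Proof.
move=> eta0; apply: adde_ge0; first exact: integral_ge0.
by rewrite adde_ge0// ?mule_ge0 ?hit_var_ge0// lee_fin ?invr_ge0 ltW.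
Qed.

Let abs_meas (f g : E -> R) : measurable_fun setT f -> measurable_fun setT g ->
  measurable_fun setT (fun x => `|f x - g x|%:E).
Proof.
by move=> mf mg; do 2 apply: measurableT_comp => //; exact: measurable_funB.
Qed.

Let measurable_int_abs m (f g : E -> R) : measurable_fun setT f ->
  measurable_fun setT g ->
  measurable_fun setT (fun z => \int[L m z]_x `|f x - g x|%:E).
Proof.
move=> mf mg; apply: measurable_fun_integral_kernel => //.
- exact: (measurable_state_law Pr_law).
- exact: abs_meas.
Qed.

Lemma measurable_pair_bound h n m eta : measurable_fun setT h ->
  measurable_fun setT (pair_bound h n m eta).
Proof.
move=> mh; apply: emeasurable_funD.
  by apply: measurable_int_abs => //; exact: measurable_hit.
by apply: emeasurable_funD => //; apply: measurable_funeM; exact: measurable_hit_var.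
Qed.

Lemma integral_abs_sub_le h n m eta z : measurable_fun setT h -> (0 < eta)%R ->
  \int[L m z]_x `|h x - hit (m + n) z|%:E <= pair_bound h n m eta z.
Proof.
move=> mh eta0; have mhn := measurable_hit n.
have m2 : measurable_fun setT (fun x => ((hit n x - hit (m + n) z) ^+ 2)%:E).
  by apply/measurable_EFinP/measurable_funX; exact: measurable_funB.
have -> : pair_bound h n m eta z = \int[L m z]_x (`|hit n x - h x|%:E +
    (eta%:E + eta^-1%:E * ((hit n x - hit (m + n) z) ^+ 2)%:E)).
  rewrite ge0_integralD//; last 3 first.
  - exact: abs_meas.
  - move=> x _; rewrite -EFinM -EFinD lee_fin addr_ge0 ?(ltW eta0)//.
    by rewrite mulr_ge0 ?invr_ge0 ?sqr_ge0// ltW.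
  - by apply: emeasurable_funD => //; exact: measurable_funeM.
  congr (_ + _); rewrite ge0_integralD//; last 3 first.
  - by move=> x _; rewrite lee_fin ltW.
  - by move=> x _; rewrite -EFinM lee_fin mulr_ge0 ?invr_ge0 ?sqr_ge0// ltW.
  - exact: measurable_funeM.
  rewrite integral_cst//= probability_setT mule1; congr (_ + _).
  rewrite ge0_integralZl_EFin//; last 2 first.
  - by move=> x _; rewrite lee_fin sqr_ge0.
  - by rewrite invr_ge0 ltW.
apply: ge0_le_integral => //.
- exact: abs_meas.
- apply: emeasurable_funD; first exact: abs_meas.
  by apply: emeasurable_funD => //; exact: measurable_funeM.
move=> x _; rewrite -EFinM -!EFinD lee_fin.
have tri : (`|h x - hit (m + n) z| <= `|hit n x - h x| + `|hit n x - hit (m + n) z|)%R.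
  by rewrite (distrC (hit n x) (h x)) ler_distD.
apply: (le_trans tri); rewrite lerD2l; set t := (hit n x - _)%R.
(* AM-GM *)
rewrite -(ler_pM2l eta0) mulrDr mulrA mulfV ?gt_eqF// mul1r -real_normK ?num_real//.
have := sqr_ge0 (eta - `|t|)%R; have := normr_ge0 t.
by move: (`|t|)%R => u; nra.
Qed.

Lemma integral_pair_bound_le h n m eta : measurable_fun setT h -> (0 < eta)%R ->
  \int[mu]_x `|hit n x - h x|%:E <= eta%:E ->
  \int[mu]_z hit_var m n z <= (eta ^+ 2)%:E ->
  \int[mu]_z pair_bound h n m eta z <= (3 * eta)%:E.
Proof.
move=> mh eta0 h_le var_le.
have ei0 : (0 <= eta^-1)%R by rewrite invr_ge0 ltW.
rewrite ge0_integralD//; last 4 first.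
- by move=> z _; exact: integral_ge0.
- by apply: measurable_int_abs => //; exact: measurable_hit.
- by move=> z _; rewrite adde_ge0// ?mule_ge0 ?hit_var_ge0// lee_fin ltW.
- by apply: emeasurable_funD => //; apply: measurable_funeM; exact: measurable_hit_var.
rewrite -(integral_invariant_state_law Pr_law mu_inv m)//; last first.
  by apply: abs_meas => //; exact: measurable_hit.
rewrite ge0_integralD//; last 3 first.
- by move=> z _; rewrite lee_fin ltW.
- by move=> z _; rewrite mule_ge0 ?hit_var_ge0// lee_fin ltW.
- by apply: measurable_funeM; exact: measurable_hit_var.
rewrite integral_cst//= probability_setT mule1 ge0_integralZl_EFin//; last 2 first.
- by move=> z _; exact: hit_var_ge0.
- exact: measurable_hit_var.
(* The variance was required to be at most [eta ^+ 2] so that it contributes [eta] after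
   division. *)
have -> : (3 * eta)%:E = eta%:E + (eta%:E + eta^-1%:E * (eta ^+ 2)%:E).
  by rewrite -EFinM -!EFinD; congr EFin; field; rewrite gt_eqF.
by rewrite leeD// leeD2l// lee_wpmul2l// lee_fin.
Qed.

End pair_convergence.

(** * The coupling inequality at a single time *)

Lemma product_probability_setT d (T : measurableType d) (R : realType)
    (mu : probability T R) : (mu \x mu) setT = 1.
Proof.
rewrite -setXTT product_measure1E// -[RHS]mule1.
by congr (_ * _); exact: probability_setT.
Qed.

Section coupling_state_law.
Context (R : realType) dE (E : measurableType dE).
Variables (Q1 Q2 : probability (paths E) R).

Lemma coupling_integral xi m (f : E -> \bar R) :
  couplings Q1 Q2 xi -> measurable_fun setT f -> (forall x, 0 <= f x) ->
  \int[xi]_w f (w.1 m) = \int[distribution Q1 (coord m)]_x f x /\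
  \int[xi]_w f (w.2 m) = \int[distribution Q2 (coord m)]_x f x.
Proof.
move=> Cxi mf f0.
have mfm : measurable_fun setT (fun w : paths E => f (w m)).
  exact: (measurableT_comp mf (@measurable_coord _ E m)).
split.
- rewrite ge0_integral_pushforward// preimage_setT.
  transitivity (\int[marginal1 xi]_u f (u m)).
    by rewrite ge0_integral_pushforward// preimage_setT.
  by apply: eq_measure_integral => B mB _; have [] := Cxi B mB.
- rewrite ge0_integral_pushforward// preimage_setT.
  transitivity (\int[marginal2 xi]_u f (u m)).
    by rewrite ge0_integral_pushforward// preimage_setT.
  by apply: eq_measure_integral => B mB _; have [] := Cxi B mB.
Qed.

End coupling_state_law.

Section pair_convergence.
Context (R : realType) dE (E : measurableType dE) (d : metric_fun R E).
Hypothesis mE : @measurable dE E = <<s @open (mspace d) >>.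
Hypothesis md : measurable_fun [set: E * E] (fun z => d z.1 z.2).
Variables (P : R.-pker E ~> E) (Pr : E -> probability (paths E) R).
Hypothesis Pr_law : forall x, markov_law P x (Pr x).
Variable mu : probability E R.
Hypothesis mu_inv : invariant_prob P mu.
Variable A : set E.
Hypothesis mA : measurable A.

Local Notation L := (state_law Pr).
Local Notation hit := (hit Pr A).
Local Notation pair_bound := (pair_bound Pr A).

(** On the close event [|a - b|] is at most [|h(X_m) - a| + |h(Y_m) - b| + l * e]. Integrated over
    the event and then enlarged to the whole space, the right side involves the marginals only, so
    the bound is the same for all couplings. *)
Lemma coupling_pair_bound (h : E -> R) (l e : R) n m eta z w xi :
  (forall x y, `|h x - h y| <= l * d x y)%R -> (0 <= l)%R -> (0 <= e)%R ->
  (0 < eta)%R -> couplings (Pr z) (Pr w) xi ->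
  xi (close_event d e m) * `|hit (m + n) z - hit (m + n) w|%:E <=
  pair_bound h n m eta z + pair_bound h n m eta w + (l * e)%:E.
Proof.
move=> hl l0 e0 eta0 Cxi; have mh := measurable_lipschitz mE hl.
set a := hit (m + n) z; set b := hit (m + n) w.
have mC := measurable_close_event md e m.
have mabs (c : R) : measurable_fun setT (fun x : E => `|h x - c|%:E).
  by do 2 apply: measurableT_comp => //; exact: measurable_funB.
have m1 c : measurable_fun setT (fun u : paths E * paths E => `|h (u.1 m) - c|%:E).
  apply: (measurableT_comp (mabs c)).
  exact: (measurableT_comp (@measurable_coord _ E m) measurable_fst).
have m2 c : measurable_fun setT (fun u : paths E * paths E => `|h (u.2 m) - c|%:E).
  apply: (measurableT_comp (mabs c)).
  exact: (measurableT_comp (@measurable_coord _ E m) measurable_snd).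
have abs0 c x : 0 <= `|h x - c|%:E by rewrite lee_fin.
pose S (u : paths E * paths E) : \bar R := `|h (u.1 m) - a|%:E + `|h (u.2 m) - b|%:E + (l * e)%:E.
have mS : measurable_fun setT S by do 2 apply: emeasurable_funD => //.
have le0 : 0 <= (l * e)%:E by rewrite lee_fin mulr_ge0.
have S0 u : 0 <= S u by rewrite !adde_ge0.
rewrite muleC -integral_cst//.
apply: (@le_trans _ _ (\int[xi]_(u in close_event d e m) S u)).
  apply: ge0_le_integral => //; first by move=> u _ /=; rewrite lee_fin.
    exact: measurable_funTS mS.
  move=> u /= due; rewrite /S -!EFinD lee_fin.
  have := hl (u.1 m) (u.2 m); have := ler_wpM2l l0 due.
  move: (h (u.1 m)) (h (u.2 m)) (l * d (u.1 m) (u.2 m))%R (l * e)%R => s t v r.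
  rewrite (distrC s a) => v_le st.
  have := ler_distD s a b; have := ler_distD t s b; lra.
apply: (@le_trans _ _ (\int[xi]_u S u)).
  by apply: ge0_subset_integral.
rewrite ge0_integralD//; [|by move=> u _; rewrite adde_ge0|exact: emeasurable_funD].
rewrite ge0_integralD// integral_cst//= probability_setT mule1.
have [-> _] := coupling_integral m Cxi (mabs a) (abs0 a).
have [_ ->] := coupling_integral m Cxi (mabs b) (abs0 b).
rewrite leeD2r// leeD//.
- exact: integral_abs_sub_le.
- exact: integral_abs_sub_le.
Qed.

Lemma exists_pair_bound (tau s : R) : (0 < tau)%R -> (0 < s)%R ->
  exists (n : nat) (e : R) (U : nat -> E * E -> \bar R), [/\ (0 < e)%R,
    forall m, measurable_fun setT (U m),
    forall m, (mu \x mu) [set p | tau%:E <= U m p] <= s%:E &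
    forall m z w xi, couplings (Pr z) (Pr w) xi ->
      xi (close_event d e m) * `|hit (m + n) z - hit (m + n) w|%:E <= U m (z, w)].
Proof.
(* The two pair bounds contribute [3 * eta] each and the Lipschitz term one [eta];
   [7 * eta = tau * s] is what the Markov inequality asks for. *)
move=> tau0 s0; pose eta := (tau * s / 7)%R.
have eta0 : (0 < eta)%R by rewrite divr_gt0// mulr_gt0.
have eta20 : (0 < eta ^+ 2)%R by rewrite exprn_gt0.
have [n n_var] := integral_hit_var_small Pr_law mu_inv mA eta20.
have hit1 x : (`|hit n x| <= 1)%R by rewrite ger0_norm ?hit_ge0// hit_le1.
have [_ /(_ _ eta0)[h [l hl h_le]]] :=
  lipschitz_approx_bounded mE mu (measurable_hit Pr_law mA n) hit1.
have mh := measurable_lipschitz mE hl.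
have hl' x y : (`|h x - h y| <= `|l| * d x y)%R.
  by rewrite (le_trans (hl x y))// ler_wpM2r ?metric_ge0// ler_norm.
pose e := (eta / (`|l| + 1))%R.
have l1 : (0 < `|l| + 1)%R by rewrite ltr_wpDl.
have e0 : (0 < e)%R by rewrite divr_gt0.
have le_eta : (`|l| * e <= eta)%R.
  by rewrite /e mulrA ler_pdivrMr// mulrC ler_pM2l// lerDl.
have le0 : (0 <= `|l| * e)%R by rewrite mulr_ge0// ltW.
pose u m z := pair_bound h n m eta z.
have mu1 m : measurable_fun setT (fun p : E * E => u m p.1).
  by apply: (measurableT_comp (measurable_pair_bound Pr_law mA n m eta mh)).
have mu2 m : measurable_fun setT (fun p : E * E => u m p.2).
  by apply: (measurableT_comp (measurable_pair_bound Pr_law mA n m eta mh)).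
have u0 m z : 0 <= u m z by exact: pair_bound_ge0.
pose U m (p : E * E) := u m p.1 + u m p.2 + (`|l| * e)%:E.
have mU m : measurable_fun setT (U m) by do 2 apply: emeasurable_funD => //.
have leE0 : 0 <= (`|l| * e)%:E by rewrite lee_fin.
have U0 m p : 0 <= U m p by apply: adde_ge0 => //; apply: adde_ge0; exact: u0.
exists n, e, U; split=> // [m|m z w xi Cxi].
  have int_u : \int[mu]_z u m z <= (3 * eta)%:E.
    by apply: (integral_pair_bound_le Pr_law mu_inv mA).
  have : \int[mu \x mu]_p U m p <= (7 * eta)%:E.
    rewrite ge0_integralD//; [|by move=> p _; apply: adde_ge0; exact: u0|exact: emeasurable_funD].
    rewrite ge0_integralD; [|exact: measurableT|by move=> p _; exact: u0|exact: mu1|by move=> p _; exact: u0|exact: mu2].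
    have -> : \int[mu \x mu]_p (`|l| * e)%:E = (`|l| * e)%:E.
      by rewrite integral_cst//= [X in _ * X]product_probability_setT mule1.
    have -> : \int[mu \x mu]_p u m p.1 = \int[mu]_z u m z.
      rewrite fubini_tonelli1//; apply: eq_integral => z _.
      by rewrite /fubini_F/= integral_cst//= probability_setT mule1.
    have -> : \int[mu \x mu]_p u m p.2 = \int[mu]_z u m z.
      by rewrite fubini_tonelli1// /fubini_F/= integral_cst//= probability_setT mule1.
    have -> : (7 * eta = 3 * eta + 3 * eta + eta)%R by ring.
    by rewrite !EFinD leeD// ?leeD// lee_fin.
  have := @le_integral_abse _ _ _ (mu \x mu) setT measurableT (U m) tau (mU m) tau0.
  rewrite setTI; under eq_integral do rewrite gee0_abs//.
  have <- : [set p | tau%:E <= `|U m p|] = [set p | tau%:E <= U m p].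
    by apply/seteqP; split=> p /=; rewrite gee0_abs.
  move=> /le_trans h1 /h1.
  have -> : (7 * eta)%:E = tau%:E * s%:E by rewrite -EFinM; congr EFin; rewrite /eta; field.
  by rewrite lee_pmul2l.
exact: (coupling_pair_bound n m hl' (normr_ge0 l) (ltW e0) eta0 Cxi).
Qed.

End pair_convergence.

(** * Convergence of the transition probabilities of a set *)

Section hit_convergence.
Context (R : realType) dE (E : measurableType dE) (d : metric_fun R E).
Hypothesis mE : @measurable dE E = <<s @open (mspace d) >>.
Hypothesis md : measurable_fun [set: E * E] (fun z => d z.1 z.2).
Variables (P : R.-pker E ~> E) (Pr : E -> probability (paths E) R).
Hypothesis Pr_law : forall x, markov_law P x (Pr x).
Variable mu : probability E R.
Hypothesis mu_inv : invariant_prob P mu.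
Variable A : set E.
Hypothesis mA : measurable A.

Local Notation hit := (hit Pr A).
Local Notation mm := (mu \x mu : set (E * E) -> \bar R).

Let mmT : mm setT < +oo.
Proof. by rewrite product_probability_setT ltry. Qed.

Let gap m (p : E * E) : R := `|hit m p.1 - hit m p.2|%R.

Let measurable_gap m : measurable_fun setT (gap m).
Proof.
have mh := measurable_hit Pr_law mA m.
apply: measurableT_comp => //; apply: measurable_funB.
- exact: measurableT_comp mh measurable_fst.
- exact: measurableT_comp mh measurable_snd.
Qed.

Let separated m (c : R) : set (E * E) := [set p | (c <= gap m p)%R].

Let measurable_separated m c : measurable (separated m c).
Proof.
rewrite (_ : separated m c = gap m @^-1` `[c, +oo[); last first.
  by apply/seteqP; split=> p; rewrite /separated /= in_itv/= andbT.
by rewrite -[X in measurable X]setTI; exact: measurable_gap.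
Qed.

(** [B] is the limsup over [m] of the pairs separated at time [m + n] whose bound [U m] is below
    [tau]. The exceptional pairs cost [s / 2] at each time, which leaves [s / 2] infinitely
    often. *)
Lemma frequently_separated (c s tau : R) : (0 < s)%R -> (0 < tau)%R ->
  (forall N, exists2 m, (N <= m)%N & s%:E <= mm (separated m c)) ->
  exists B : set (E * E), [/\ measurable B, (s / 2)%:E <= mm B &
    forall z w, B (z, w) -> exists2 e : R, (0 < e)%R &
      forall N, exists2 m, (N <= m)%N & forall xi, couplings (Pr z) (Pr w) xi ->
        xi (close_event d e m) * c%:E < tau%:E].
Proof.
move=> s0 tau0 sepS; have s20 : (0 < s / 2)%R by rewrite divr_gt0.
have [n [e [U [e0 mU U_le xi_le]]]] :=
  exists_pair_bound mE md Pr_law mu_inv mA tau0 s20.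
pose F m := separated (m + n) c `&` [set p | U m p < tau%:E].
have mUlt m : measurable [set p | U m p < tau%:E].
  by rewrite -[X in measurable X]setTI; exact: emeasurable_fun_infty_o.
have mUge m : measurable [set p | tau%:E <= U m p].
  by rewrite -[X in measurable X]setTI; exact: emeasurable_fun_c_infty.
have mF m : measurable (F m) by exact: measurableI.
exists (lim_sup_set F); split.
- by apply: bigcap_measurable => // k _; apply: bigcup_measurable => j _.
- apply: frequently_lim_sup_set => // N.
  (* Separation is observed at time [m'] while the coupling acts [n] steps earlier. *)
  have [m' Nm' sm'] := sepS (N + n)%N.
  have nm' : (n <= m')%N by rewrite (leq_trans _ Nm')// leq_addl.
  exists (m' - n)%N; first by rewrite leq_subRL// addnC.
  have : s%:E <= mm (F (m' - n)%N) + (s / 2)%:E.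
    apply: (le_trans sm'); apply: le_trans (leeD2l _ (U_le (m' - n)%N)).
    apply: le_trans (measureU2 _ (mF _) (mUge _)); apply: measure_subset => //.
      exact: measurableU.
    move=> p sp; have [pU|pU] := leP tau%:E (U (m' - n)%N p); first by right.
    by left; split=> //; rewrite subnK.
  by rewrite {1}(splitr s) EFinD leeD2rE.
move=> z w Bzw; exists e => // N; have [m Nm [sep Um]] := Bzw N I.
exists m => // xi Cxi; apply: le_lt_trans Um.
apply: le_trans (xi_le m _ _ _ Cxi).
by rewrite lee_wpmul2l// lee_fin.
Qed.

Variable M : set (E * E).
Hypothesis mM : measurable M.
Hypothesis M1 : mm M = 1.
Hypothesis M_cond : forall x y, M (x, y) -> cond_i d (Pr x) (Pr y).

(** Otherwise the previous lemma applies with every tolerance [1 / j.+1], and the limsup of the sets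
    [B j] still has measure at least [s / 2], so it meets [M]. At a common pair the constant [a] of
    (i) would satisfy [a * c < 1 / j.+1] for arbitrarily large [j]. *)
Lemma separated_small (c s : R) : (0 < c)%R -> (0 < s)%R ->
  exists N, forall m, (N <= m)%N -> mm (separated m c) <= s%:E.
Proof.
move=> c0 s0; apply: contrapT => /forallNP sepN.
have sep N : exists2 m, (N <= m)%N & s%:E <= mm (separated m c).
  have /existsNP[m /not_implyP[Nm /negP]] := sepN N.
  by rewrite -ltNge => /ltW; exists m.
have tau0 (j : nat) : (0 < j.+1%:R^-1 :> R)%R by rewrite invr_gt0.
have /choice[B BP] := fun j => frequently_separated s0 (tau0 j) sep.
have mB j : measurable (B j) by have [] := BP j.
have mBsup : measurable (lim_sup_set B).
  by apply: bigcap_measurable => // k _; apply: bigcup_measurable => j _.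
have Bsup : (s / 2)%:E <= mm (lim_sup_set B).
  by apply: frequently_lim_sup_set => // N; exists N => //; have [] := BP N.
have mmMC : mm (~` M) = 0.
  have : mm M + mm (~` M) = 1.
    rewrite -(product_probability_setT mu) -(setUv M) measureU//.
    - exact: measurableC.
    - exact: setICr.
  rewrite M1; case: (mm (~` M)) => [r| |] //; rewrite -EFinD => -[] /eqP.
  by rewrite eq_sym addrC -subr_eq subrr => /eqP <-.
have [[x y] [Bxy Mxy]] : lim_sup_set B `&` M !=set0.
  apply/set0P/negP => /eqP BM0.
  have : mm (lim_sup_set B) <= mm (~` M).
    apply: measure_subset => //; first exact: measurableC.
    by apply/disjoints_subset.
  rewrite mmMC => /(le_trans Bsup); rewrite lee_fin leNgt => /negP; apply.
  by rewrite divr_gt0.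
have /(sup_close_gt0 md)[a a0 a_close] := M_cond Mxy.
(* Such a [j] has [j.+1 > 1 / (a * c)], and its own [e] is passed to (i) afterwards. *)
have [j /= Jj Bj] := Bxy (Num.truncn (a * c)^-1) I.
have [_ _ /(_ x y Bj)[e e0 freq]] := BP j.
have [N _ closeN] := a_close e e0.
have [m Nm small] := freq N.
have [xi Cxi a_le] := closeN m Nm.
have : a%:E * c%:E < j.+1%:R^-1%:E.
  by apply: le_lt_trans (small xi Cxi); rewrite lee_wpmul2r// lee_fin ltW.
rewrite -EFinM lte_fin; apply/negP; rewrite -leNgt.
rewrite -[leRHS]invrK lef_pV2 ?posrE ?invr_gt0 ?mulr_gt0//.
by rewrite (le_trans (ltW (truncnS_gt _)))// ler_nat.
Qed.

(** By invariance [mu A] is the mean of [hit m], so its distance to [hit m x] is at most the mean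
    over [y] of the gap between [x] and [y]. *)
Lemma hit_cvg (t : R) : (0 < t)%R -> exists N, forall m, (N <= m)%N ->
  \int[mu]_x `|hit m x - fine (mu A)|%:E <= t%:E.
Proof.
move=> t0; have t20 : (0 < t / 2)%R by rewrite divr_gt0.
have [N sepN] := separated_small t20 t20.
exists N => m Nm; have mh := measurable_hit Pr_law mA m.
have muAE : \int[mu]_y (hit m y)%:E = mu A.
  rewrite (invariant_state_law Pr_law mu_inv m)//.
  by apply: eq_integral => y _; rewrite hitE.
have mgapE : measurable_fun setT (fun p => (gap m p)%:E).
  by apply/measurable_EFinP; exact: measurable_gap.
have gap0 p : 0 <= (gap m p)%:E by rewrite lee_fin /gap.
apply: (@le_trans _ _ (\int[mm]_p (gap m p)%:E)).
  rewrite fubini_tonelli1//.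
  have msec x : measurable_fun setT (fun y => (gap m (x, y))%:E).
    by do 2 apply: measurableT_comp => //; exact: measurable_funB.
  apply: ge0_le_integral => //.
  - by do 2 apply: measurableT_comp => //; exact: measurable_funB.
  - exact: measurable_fun_fubini_tonelli_F.
  move=> x _; rewrite /fubini_F /=.
  have hx0 : 0 <= (hit m x)%:E by rewrite lee_fin hit_ge0.
  have muAfin : (fine (mu A))%:E = mu A by rewrite fineK// fin_num_measure.
  have h1 : (hit m x)%:E <= \int[mu]_y (gap m (x, y))%:E + mu A.
    rewrite -muAE -ge0_integralD//; last 2 first.
    - by move=> y _; rewrite lee_fin hit_ge0.
    - exact/measurable_EFinP.
    rewrite -[leLHS]mule1 -(@probability_setT _ _ _ mu) -integral_cst//.
    apply: ge0_le_integral => //.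
      by apply: emeasurable_funD => //; exact/measurable_EFinP.
    move=> y _; rewrite -EFinD lee_fin /gap /=.
    by have := ler_norm (hit m x - hit m y)%R; lra.
  have h2 : mu A <= \int[mu]_y (gap m (x, y))%:E + (hit m x)%:E.
    rewrite -[X in _ + X]mule1 -(@probability_setT _ _ _ mu) -integral_cst//.
    rewrite -ge0_integralD// -muAE.
    apply: ge0_le_integral => //.
    - by move=> y _; rewrite lee_fin hit_ge0.
    - exact/measurable_EFinP.
    - exact: emeasurable_funD.
    move=> y _; rewrite -EFinD lee_fin /gap /=.
    by have := ler_norm (hit m y - hit m x)%R; rewrite distrC; lra.
  have I0 : 0 <= \int[mu]_y (gap m (x, y))%:E by exact: integral_ge0.
  move: I0 h1 h2; rewrite -muAfin.
  case: (\int[mu]_y _) => [r _| _ _ _|]; [|exact: leey|by []].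
  by rewrite -!EFinD !lee_fin ler_norml => h1 h2; apply/andP; split; lra.
(* The gap never exceeds 1, so on the separated set the indicator bounds it. *)
apply: (@le_trans _ _ (\int[mm]_p ((t / 2)%:E + (\1_(separated m (t / 2)%R) p)%:E))).
  apply: ge0_le_integral => //.
  - apply: emeasurable_funD => //.
    by apply/measurable_EFinP; exact: measurable_indic.
  move=> p _; rewrite -EFinD lee_fin indicE.
  have [ps|ps] := pselect (separated m (t / 2)%R p).
    rewrite mem_set//= /gap; have := hit_ge0 Pr mA m p.1; have := hit_le1 Pr mA m p.1.
    have := hit_ge0 Pr mA m p.2; have := hit_le1 Pr mA m p.2.
    by move=> *; apply: (@le_trans _ _ 1%R); [rewrite ler_norml; apply/andP; split; lra|lra].
  by rewrite memNset//= addr0 ltW// ltNge; exact/negP.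
rewrite ge0_integralD//; last 2 first.
- by move=> p _; rewrite lee_fin ltW.
- by apply/measurable_EFinP; exact: measurable_indic.
rewrite integral_cst//= [X in _ * X]product_probability_setT mule1.
rewrite [X in _ <= X%:E](splitr t) EFinD.
by rewrite leeD2l// integral_indic// setIT; exact: sepN.
Qed.

End hit_convergence.

(** * Transport plans between cells *)

Section transport.
Context (R : realType) dE (E : measurableType dE) (d : metric_fun R E).
Hypothesis mE : @measurable dE E = <<s @open (mspace d) >>.
Hypothesis md : measurable_fun [set: E * E] (fun z => d z.1 z.2).
Variables (s : nat -> E).
Hypothesis s_dense : forall x e, (0 < e)%R -> exists n, (d x (s n) < e)%R.
Variable D : R.
Hypothesis dD : forall x y, (d x y <= D)%R.

Definition cell (r : R) : nat -> set E :=
  seqDU (fun i => [set x | (d x (s i) < r)%R]).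

Lemma measurable_cell r i : measurable (cell r i).
Proof.
apply: measurableD; first exact/(measurable_open mE)/open_metric_lt.
by apply: bigsetU_measurable => j _; exact/(measurable_open mE)/open_metric_lt.
Qed.

Lemma cell_lt r i x : cell r i x -> (d x (s i) < r)%R.
Proof. by case. Qed.

Lemma trivIset_cell r : trivIset setT (cell r).
Proof. exact: trivIset_seqDU. Qed.

Lemma cell_inj r i j x : cell r i x -> cell r j x -> i = j.
Proof.
move=> xi xj; apply/eqP; apply/negPn/negP => ij.
have /trivIsetP/(_ i j I I ij) := @trivIset_cell r.
by rewrite -subset0 => /(_ x); apply.
Qed.

Lemma cell_cover r x : (0 < r)%R -> exists i, cell r i x.
Proof.
move=> r0; have [n xn] := s_dense x r0.
have : (\bigcup_i cell r i) x by rewrite -seqDU_bigcup_eq; exists n.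
by case=> i _ xi; exists i.
Qed.

Lemma cell_metric r i j x y : cell r i x -> cell r j y ->
  (d x y <= d (s i) (s j) + 2 * r)%R /\ (d (s i) (s j) <= d x y + 2 * r)%R.
Proof.
move=> /cell_lt xi /cell_lt yj.
have := metric_tri d (s i) x y; have := metric_tri d (s j) (s i) y.
have := metric_tri d x (s i) (s j); have := metric_tri d y x (s j).
rewrite (metric_symm d (s j) y) (metric_symm d (s i) x) => *.
by split; lra.
Qed.

(* At most one term of the double sum is nonzero. *)
Lemma sum_cell (r : R) N (c : nat -> nat -> R) (x y : E) (b : R) : (0 <= b)%R ->
  (forall i j, cell r i x -> cell r j y -> c i j <= b)%R ->
  (\sum_(i < N) \sum_(j < N) c i j * \1_(cell r i `*` cell r j) (x, y) <= b)%R.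
Proof.
move=> b0 cb.
have [[i [iN xi]]|nx] := pselect (exists i, (i < N)%N /\ cell r i x); last first.
  rewrite big1// => i _; rewrite big1// => j _.
  by rewrite indicE memNset ?mulr0// => -[/= xi _]; apply: nx; exists i.
have [[j [jN yj]]|ny] := pselect (exists j, (j < N)%N /\ cell r j y); last first.
  rewrite big1// => k _; rewrite big1// => j _.
  by rewrite indicE memNset ?mulr0// => -[/= _ yj]; apply: ny; exists j.
rewrite (bigD1 (Ordinal iN))//= [X in (_ + X <= _)%R]big1 ?addr0; last first.
  move=> k /eqP ki; rewrite big1// => l _; rewrite indicE memNset ?mulr0//.
  by move=> [/= xk _]; apply: ki; apply/val_inj => /=; exact: cell_inj xk xi.
rewrite (bigD1 (Ordinal jN))//= big1 ?addr0; last first.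
  move=> l /eqP lj; rewrite indicE memNset ?mulr0//.
  by move=> [/= _ yl]; apply: lj; apply/val_inj => /=; exact: cell_inj yl yj.
by rewrite indicE mem_set// mulr1; exact: cb.
Qed.

Lemma measurable_metricE : measurable_fun [set: E * E] (fun z => (d z.1 z.2)%:E).
Proof. exact/measurable_EFinP. Qed.

Lemma measurable_sum_cell r N (c : nat -> nat -> R) :
  measurable_fun setT (fun z : E * E =>
    \sum_(i < N) \sum_(j < N) c i j * \1_(cell r i `*` cell r j) z)%R.
Proof.
apply: measurable_sum => i; apply: measurable_sum => j.
apply: measurable_funM => //; apply: measurable_indic.
by apply: measurableX; exact: measurable_cell.
Qed.

Lemma integral_sum_cell (xi : probability (E * E)%type R) r N (c : nat -> nat -> R) :
  (forall i j, 0 <= c i j)%R ->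
  \int[xi]_z (\sum_(i < N) \sum_(j < N) c i j * \1_(cell r i `*` cell r j) z)%:E =
  \sum_(i < N) \sum_(j < N) (c i j)%:E * xi (cell r i `*` cell r j).
Proof.
move=> c0; have mC i j : measurable (cell r i `*` cell r j).
  by apply: measurableX; exact: measurable_cell.
have mI i j : measurable_fun setT (fun z => (c i j * \1_(cell r i `*` cell r j) z)%:E).
  by apply/measurable_EFinP/measurable_funM => //; exact: measurable_indic.
under eq_integral.
  move=> z _; rewrite -sumEFin; under eq_bigr do rewrite -sumEFin.
  over.
rewrite ge0_integral_sum//; last 2 first.
- by move=> i; apply: emeasurable_sum => j.
- by move=> i z _; apply: sume_ge0 => j _; rewrite lee_fin mulr_ge0.
apply: eq_bigr => i _; rewrite ge0_integral_sum//; last first.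
  by move=> j z _; rewrite lee_fin mulr_ge0.
apply: eq_bigr => j _; under eq_integral do rewrite EFinM.
rewrite ge0_integralZl_EFin//; last first.
  by apply/measurable_EFinP; exact: measurable_indic.
by rewrite integral_indic// setIT.
Qed.

Let mCC r i j : measurable (cell r i `*` cell r j).
Proof. by apply: measurableX; exact: measurable_cell. Qed.

(* The plan puts mass [q i j] on the rectangle [cell i * cell j], distributed
   like the product measure; the quotient [0 / 0 = 0] takes care of null cells. *)
Lemma plan_measure (al be : probability E R) (r : R) N (q : nat -> nat -> R) :
  (forall i j, 0 <= q i j)%R ->
  (forall i, (i < N)%N -> (\sum_(j < N) q i j)%:E <= al (cell r i)) ->
  (forall j, (j < N)%N -> (\sum_(i < N) q i j)%:E <= be (cell r j)) ->
  exists2 xi, couplings al be xi &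
    forall i j, (i < N)%N -> (j < N)%N -> (q i j)%:E <= xi (cell r i `*` cell r j).
Proof.
move=> q0 qal qbe.
pose a i := fine (al (cell r i)); pose b j := fine (be (cell r j)).
have aE i : (a i)%:E = al (cell r i).
  by rewrite /a fineK// fin_num_measure//; exact: measurable_cell.
have bE j : (b j)%:E = be (cell r j).
  by rewrite /b fineK// fin_num_measure//; exact: measurable_cell.
have a0 i : (0 <= a i)%R by rewrite -lee_fin aE.
have b0 j : (0 <= b j)%R by rewrite -lee_fin bE.
have w0 i j : (0 <= q i j / (a i * b j))%R by rewrite divr_ge0// mulr_ge0.
pose piece i j : {measure set (E * E) -> \bar R} :=
  mscale (NngNum (w0 i j)) (mrestr (al \x be) (mCC r i j)).
pose m : {measure set (E * E) -> \bar R} := msum (fun i => msum (piece i) N) N.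
have mE' C : m C = \sum_(i < N) \sum_(j < N) piece i j C by [].
have pieceE i j A B : measurable A -> measurable B -> piece i j (A `*` B) =
    (q i j / (a i * b j))%:E * (al (A `&` cell r i) * be (B `&` cell r j)).
  move=> mA mB; rewrite -product_measure1E; last 2 first.
  - by apply: measurableI => //; exact: measurable_cell.
  - by apply: measurableI => //; exact: measurable_cell.
  by rewrite setXI.
have qa i j : (i < N)%N -> (j < N)%N -> (q i j <= a i)%R.
  move=> iN jN; rewrite -lee_fin aE (le_trans _ (qal i iN))// lee_fin.
  by rewrite (bigD1 (Ordinal jN))//= lerDl sumr_ge0.
have qb i j : (i < N)%N -> (j < N)%N -> (q i j <= b j)%R.
  move=> iN jN; rewrite -lee_fin bE (le_trans _ (qbe j jN))// lee_fin.
  by rewrite (bigD1 (Ordinal iN))//= lerDl sumr_ge0.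
have disj (ka : probability E R) A : measurable A ->
    \sum_(i < N) ka (A `&` cell r i) <= ka A.
  move=> mA; rewrite -measure_bigsetU_ord//; last 2 first.
  - by move=> i; apply: measurableI => //; exact: measurable_cell.
  - move=> i j _ _ [x [[_ xi] [_ xj]]].
    by apply/val_inj; exact: cell_inj xi xj.
  apply: measure_subset => //.
    by apply: bigsetU_measurable => i _; apply: measurableI => //; exact: measurable_cell.
  by move=> x; rewrite -(bigcup_mkord N (fun i => A `&` cell r i)) => -[i _ []].
have quo (x y : R) : (0 <= x)%R -> (0 <= y)%R -> (x / y * y <= x)%R.
  move=> x0 y0; have [->|yn0] := eqVneq y 0%R; first by rewrite mulr0.
  by rewrite divfK.
have fin_cap (ka : probability E R) A i : measurable A ->
    exists2 u : R, (0 <= u)%R & ka (A `&` cell r i) = u%:E.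
  move=> mA; exists (fine (ka (A `&` cell r i))); first by rewrite fine_ge0.
  by rewrite fineK// fin_num_measure//; apply: measurableI => //; exact: measurable_cell.
have cap_le (ka : probability E R) A i : measurable A ->
    ka (A `&` cell r i) <= ka (cell r i).
  move=> mA; apply: measure_subset; [|exact: measurable_cell|exact: subIsetr].
  by apply: measurableI => //; exact: measurable_cell.
have [A mA|A mA|xi Cxi m_xi] := @subcoupling_extend _ _ _ al be m.
- rewrite mE'; apply: (le_trans _ (disj al A mA)); apply: lee_sum => i _.
  have [u u0 uE] := fin_cap al A i mA; rewrite uE.
  have ua : (u <= a i)%R by rewrite -lee_fin -uE aE; exact: cap_le.
  (* Each piece factors through the slice mass [u]; cancelling [b j] is only an inequality because
     [b j] may be zero. *)
  apply: (@le_trans _ _ (\sum_(j < N) (q i j / a i * u)%:E)).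
    apply: lee_sum => j _; rewrite pieceE// uE setTI -bE -!EFinM lee_fin.
    rewrite invfM [leLHS](_ : _ = (q i j / b j * b j) * (u / a i))%R; last by ring.
    rewrite [leRHS](_ : _ = q i j * (u / a i))%R; last by ring.
    by rewrite ler_wpM2r ?divr_ge0// quo.
  rewrite sumEFin lee_fin -!mulr_suml.
  have [ai0|ai0] := eqVneq (a i) 0%R; first by rewrite ai0 invr0 mulr0 mul0r.
  rewrite ler_piMl// ler_pdivrMr ?mul1r ?lt_def ?ai0 ?a0//.
  by rewrite -lee_fin aE; exact: qal.
- rewrite mE' exchange_big /=; apply: (le_trans _ (disj be A mA)); apply: lee_sum => j _.
  have [u u0 uE] := fin_cap be A j mA; rewrite uE.
  have ub : (u <= b j)%R by rewrite -lee_fin -uE bE; exact: cap_le.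
  apply: (@le_trans _ _ (\sum_(i < N) (q i j / b j * u)%:E)).
    apply: lee_sum => i _; rewrite pieceE// uE setTI -aE -!EFinM lee_fin.
    rewrite invfM [leLHS](_ : _ = (q i j / a i * a i) * (u / b j))%R; last by ring.
    rewrite [leRHS](_ : _ = q i j * (u / b j))%R; last by ring.
    by rewrite ler_wpM2r ?divr_ge0// quo.
  rewrite sumEFin lee_fin -!mulr_suml.
  have [bj0|bj0] := eqVneq (b j) 0%R; first by rewrite bj0 invr0 mulr0 mul0r.
  rewrite ler_piMl// ler_pdivrMr ?mul1r ?lt_def ?bj0 ?b0//.
  by rewrite -lee_fin bE; exact: qbe.
exists xi => // i j iN jN; apply: (le_trans _ (m_xi _ (mCC r i j))).
rewrite mE' (bigD1 (Ordinal iN))//= (bigD1 (Ordinal jN))//=.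
apply: (@le_trans _ _ (piece i j (cell r i `*` cell r j))); last first.
  rewrite -addeA leeDl// adde_ge0//; first by apply: sume_ge0.
  by apply: sume_ge0 => k _; exact: sume_ge0.
rewrite pieceE ?setIid; [|exact: measurable_cell..].
rewrite -aE -bE -!EFinM lee_fin.
have [ai0|ai0] := eqVneq (a i) 0%R; first by rewrite ai0 mul0r mulr0 -ai0 qa.
have [bj0|bj0] := eqVneq (b j) 0%R; first by rewrite bj0 !mulr0 -bj0 qb.
by rewrite divfK// mulf_neq0.
Qed.

(** The plan gives only lower bounds on the mass of rectangles, so the saving with respect to [D] is
    integrated instead of the cost: [d] plus the saving [w] on each rectangle is at most [D]. Mass
    outside the plan is charged [D]. *)
Lemma coupling_dist_plan (al be : probability E R) (r : R) N (q : nat -> nat -> R) :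
  (forall i j, 0 <= q i j)%R ->
  (forall i, (i < N)%N -> (\sum_(j < N) q i j)%:E <= al (cell r i)) ->
  (forall j, (j < N)%N -> (\sum_(i < N) q i j)%:E <= be (cell r j)) ->
  coupling_dist d al be <=
  (\sum_(i < N) \sum_(j < N) q i j * (d (s i) (s j) + 2 * r) +
   D * (1 - \sum_(i < N) \sum_(j < N) q i j))%:E.
Proof.
move=> q0 qal qbe; have [xi Cxi q_xi] := plan_measure q0 qal qbe.
apply: (@le_trans _ _ (\int[xi]_z (d z.1 z.2)%:E)).
  by apply: ereal_inf_lbound; exists xi.
pose w i j : R := Num.max 0%R (D - (d (s i) (s j) + 2 * r))%R.
have w0 i j : (0 <= w i j)%R by rewrite /w le_max lexx.
have : \int[xi]_z (d z.1 z.2)%:E + \sum_(i < N) \sum_(j < N) (w i j)%:E *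
    xi (cell r i `*` cell r j) <= D%:E.
  rewrite -integral_sum_cell// -ge0_integralD//; last 4 first.
  - by move=> z _; rewrite lee_fin metric_ge0.
  - exact: measurable_metricE.
  - by move=> z _; rewrite lee_fin; do 2 apply: sumr_ge0 => ? _; rewrite mulr_ge0.
  - by apply/measurable_EFinP; exact: measurable_sum_cell.
  rewrite -[leRHS]mule1 -(@probability_setT _ _ _ xi) -integral_cst//.
  apply: ge0_le_integral => //.
  - move=> z _; rewrite -EFinD lee_fin addr_ge0 ?metric_ge0//.
    by do 2 apply: sumr_ge0 => ? _; rewrite mulr_ge0.
  - apply: emeasurable_funD; first exact: measurable_metricE.
    by apply/measurable_EFinP; exact: measurable_sum_cell.
  move=> [x y] _; rewrite -EFinD lee_fin -lerBrDl.
  apply: sum_cell => [|i j xi' yj]; first by rewrite subr_ge0.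
  rewrite /w ge_max subr_ge0 dD /=; have [h _] := cell_metric xi' yj; lra.
have le_w : (\sum_(i < N) \sum_(j < N) w i j * q i j)%:E <=
    \sum_(i < N) \sum_(j < N) (w i j)%:E * xi (cell r i `*` cell r j).
  rewrite -sumEFin; apply: lee_sum => i _; rewrite -sumEFin; apply: lee_sum => j _.
  by rewrite EFinM lee_wpmul2l ?lee_fin// q_xi.
move=> /(le_trans (leeD2l _ le_w)).
have I0 : 0 <= \int[xi]_z (d z.1 z.2)%:E.
  by apply: integral_ge0 => z _; rewrite lee_fin metric_ge0.
move: I0; case: (\int[xi]_z _) => [v _| |//]; last by rewrite /= leye_eq.
rewrite -EFinD !lee_fin => vw.
have : (D * (\sum_(i < N) \sum_(j < N) q i j) <=
    \sum_(i < N) \sum_(j < N) q i j * (d (s i) (s j) + 2 * r) +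
    \sum_(i < N) \sum_(j < N) w i j * q i j)%R.
  rewrite -big_split/= mulr_sumr; apply: ler_sum => i _.
  rewrite -big_split/= mulr_sumr; apply: ler_sum => j _.
  rewrite (mulrC (q i j)) -mulrDl ler_wpM2r// -lerBlDl /w le_max lexx orbT.
  by [].
by move: vw; move: (\sum_(i < N) _)%R (\sum_(i < N) _)%R (\sum_(i < N) _)%R => *; lra.
Qed.

End transport.

(** * Measurability of the transport distance *)

Section transport_measurability.
Context (R : realType) dE (E : measurableType dE) (d : metric_fun R E).
Hypothesis mE : @measurable dE E = <<s @open (mspace d) >>.
Hypothesis md : measurable_fun [set: E * E] (fun z => d z.1 z.2).
Variables (s : nat -> E).
Hypothesis s_dense : forall x e, (0 < e)%R -> exists n, (d x (s n) < e)%R.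
Variable D : R.
Hypothesis dD : forall x y, (d x y <= D)%R.

Local Notation cell := (cell d s).

(** A matrix of multiples of [1 / n.+1], coded in a countable type so that unions over all plans are
    countable. *)
Definition grid_plan (n : nat) (c : seq (seq nat)) (i j : nat) : R :=
  ((nth 0%N (nth [::] c i) j)%:R / n.+1%:R)%R.

Definition plan_cost (k N n : nat) (c : seq (seq nat)) : R :=
  (\sum_(i < N) \sum_(j < N) grid_plan n c i j * (d (s i) (s j) + 2 * k.+1%:R^-1) +
   D * (1 - \sum_(i < N) \sum_(j < N) grid_plan n c i j))%R.

Lemma grid_plan_ge0 n c i j : (0 <= grid_plan n c i j)%R.
Proof. by rewrite divr_ge0. Qed.

Lemma coupling_cell_small (xi : probability (E * E)%type R) (r e : R) :
  (0 < r)%R -> (0 < e)%R -> exists N,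
    (1 - e)%:E <= \sum_(i < N) \sum_(j < N) xi (cell r i `*` cell r j).
Proof.
move=> r0 e0; have mC i j : measurable (cell r i `*` cell r j).
  by apply: measurableX; exact: measurable_cell.
pose B N := \bigcup_(i < N) \bigcup_(j < N) (cell r i `*` cell r j).
have mB N : measurable (B N).
  by apply: bigcup_measurable => i _; apply: bigcup_measurable => j _.
have [|||N BN] := @nonincreasing_measure_small _ _ _ xi (fun N => ~` B N) e _ _ _ e0.
- by move=> N; exact: measurableC.
- move=> m n mn x nBx [i /= im [j /= jm xij]]; apply: nBx.
  by exists i; [exact: leq_trans mn|exists j => //=; exact: leq_trans mn].
- rewrite -subset0 => -[x y] nB; have [i xi'] := cell_cover s_dense x r0.
  have [j yj] := cell_cover s_dense y r0; apply: (nB (maxn i j).+1 I).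
  by exists i; [rewrite /= ltnS leq_maxl|exists j => //=; rewrite ltnS leq_maxr].
exists N; have -> : \sum_(i < N) \sum_(j < N) xi (cell r i `*` cell r j) = xi (B N).
  rewrite /B bigcup_mkord measure_bigsetU_ord//; last 2 first.
  - by move=> i; apply: bigcup_measurable => j _.
  - move=> i j _ _ [[x y] [[k _ [/= xi' _]] [l _ [/= xj _]]]].
    by apply/val_inj; exact: cell_inj xi' xj.
  apply: eq_bigr => i _; rewrite bigcup_mkord measure_bigsetU_ord//.
  move=> j k _ _ [[x y] [[/= _ yj] [/= _ yk]]].
  by apply/val_inj; exact: cell_inj yj yk.
have := probability_setC xi (mB N); move: BN => /[swap] ->.
rewrite -(fineK (fin_num_measure xi _ (mB N))) -EFinB !lee_fin; lra.
Qed.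

(** A nearly optimal coupling, read on finitely many cells and rounded down to a grid, is a plan
    whose cost is still below [t]. The condition then involves [al] only through finitely many cell
    masses. *)
Lemma coupling_dist_ltP (al be : probability E R) (t : R) :
  coupling_dist d al be < t%:E <->
  exists k N n c, [/\ (plan_cost k N n c < t)%R,
    forall i, (i < N)%N ->
      (\sum_(j < N) grid_plan n c i j)%:E <= al (cell k.+1%:R^-1 i) &
    forall j, (j < N)%N ->
      (\sum_(i < N) grid_plan n c i j)%:E <= be (cell k.+1%:R^-1 j)].
Proof.
split=> [|[k [N [n [c [cost_lt c_al c_be]]]]]]; last first.
  apply: le_lt_trans (coupling_dist_plan mE md dD (@grid_plan_ge0 n c) c_al c_be) _.
  by rewrite lte_fin.
move=> /ereal_inf_lt[_ [xi Cxi <-]].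
have : 0 <= \int[xi]_z (d z.1 z.2)%:E.
  by apply: integral_ge0 => z _; rewrite lee_fin metric_ge0.
case vE : (\int[xi]_z (d z.1 z.2)%:E) => [v| |//]; last by move=> _; rewrite ltNge leey.
rewrite lee_fin lte_fin => v0 vt.
have D0 : (0 <= D)%R by rewrite -(metric_xx d (s 0%N)); exact: dD.
(* The slack [g] pays three errors of at most a quarter each: [4 * r] for the cells, the mass
   outside the first [N] cells, and the rounding. [D + 1] stands for [D] to have a positive
   divisor. *)
pose g := (t - v)%R; have g0 : (0 < g)%R by rewrite subr_gt0.
have [k kg] : exists k, (4 * k.+1%:R^-1 < g / 4)%R.
  exists (Num.truncn (16 / g)); have := truncnS_gt (16 / g).
  by rewrite ltr_pdivrMr// => h; rewrite ltr_pdivrMr//; lra.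
set r := (k.+1%:R^-1 : R)%R; have r0 : (0 < r)%R by rewrite invr_gt0.
have e0 : (0 < g / (4 * (D + 1)))%R by rewrite divr_gt0// mulr_gt0// ltr_wpDl.
have [N NE] := coupling_cell_small xi r0 e0.
have mC i : measurable (cell r i) by exact: measurable_cell.
have mCC i j : measurable (cell r i `*` cell r j) by exact: measurableX.
pose m i j : R := fine (xi (cell r i `*` cell r j)).
have mE' i j : (m i j)%:E = xi (cell r i `*` cell r j).
  by rewrite fineK// fin_num_measure.
have m0 i j : (0 <= m i j)%R by rewrite -lee_fin mE'.
have sum_m : (1 - g / (4 * (D + 1)) <= \sum_(i < N) \sum_(j < N) m i j)%R.
  rewrite -lee_fin (le_trans NE)// -sumEFin; apply: lee_sum => i _.
  by rewrite -sumEFin; apply: lee_sum => j _; rewrite mE'.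
have cost_m : (\sum_(i < N) \sum_(j < N) m i j * (d (s i) (s j) + 2 * r) <= v + 4 * r)%R.
  pose w i j := (d (s i) (s j) + 2 * r)%R.
  have w0 i j : (0 <= w i j)%R by rewrite addr_ge0 ?metric_ge0// mulr_ge0// ltW.
  have : \int[xi]_z (\sum_(i < N) \sum_(j < N) w i j * \1_(cell r i `*` cell r j) z)%:E
      <= \int[xi]_z ((d z.1 z.2)%:E + (4 * r)%:E).
    apply: ge0_le_integral => //.
    - by move=> z _; rewrite lee_fin; do 2 apply: sumr_ge0 => ? _; rewrite mulr_ge0.
    - by apply/measurable_EFinP; exact: measurable_sum_cell.
    - by apply: emeasurable_funD => //; exact: measurable_metricE.
    move=> [x y] _; rewrite -EFinD lee_fin; apply: sum_cell => [|i j xi' yj].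
      by rewrite addr_ge0 ?metric_ge0// mulr_ge0// ltW.
    by rewrite /w /=; have [_] := cell_metric xi' yj; lra.
  rewrite integral_sum_cell// ge0_integralD//; last 3 first.
  - by move=> z _; rewrite lee_fin metric_ge0.
  - exact: measurable_metricE.
  - by move=> z _; rewrite lee_fin mulr_ge0// ltW.
  rewrite vE integral_cst//= probability_setT mule1 -EFinD -lee_fin.
  apply: le_trans; rewrite -sumEFin; apply: lee_sum => i _.
  rewrite -sumEFin; apply: lee_sum => j _.
  by rewrite EFinM mE' muleC.
(* Rounding down loses at most [1 / n.+1] on each of the [N * N] entries. *)
pose n := Num.truncn (4 * (D + 1) * (N * N)%N%:R / g)%R.
pose c := mkseq (fun i => mkseq (fun j => Num.truncn (n.+1%:R * m i j)) N) N.
have n0 : (0 < n.+1%:R :> R)%R by [].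
have qE i j : (i < N)%N -> (j < N)%N ->
    grid_plan n c i j = ((Num.truncn (n.+1%:R * m i j))%:R / n.+1%:R)%R.
  by move=> iN jN; rewrite /grid_plan !nth_mkseq.
have q_le i j : (i < N)%N -> (j < N)%N -> (grid_plan n c i j <= m i j)%R.
  move=> iN jN; rewrite qE// ler_pdivrMr// mulrC.
  by rewrite truncn_le// mulr_ge0.
have q_ge i j : (i < N)%N -> (j < N)%N -> (m i j - n.+1%:R^-1 <= grid_plan n c i j)%R.
  move=> iN jN; rewrite qE// ler_pdivlMr// mulrBl mulVf ?gt_eqF// mulrC.
  by rewrite lerBlDr ltW// natr1 truncnS_gt.
have nN : ((D + 1) * ((N * N)%N%:R / n.+1%:R) <= g / 4)%R.
  rewrite mulrA ler_pdivrMr//; have := truncnS_gt (4 * (D + 1) * (N * N)%N%:R / g)%R.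
  by rewrite -/n ltr_pdivrMr// => h; lra.
have sum_q : (\sum_(i < N) \sum_(j < N) m i j - (N * N)%N%:R / n.+1%:R <=
    \sum_(i < N) \sum_(j < N) grid_plan n c i j)%R.
  have -> : ((N * N)%N%:R / n.+1%:R = \sum_(i < N) \sum_(j < N) n.+1%:R^-1 :> R)%R.
    by rewrite !sumr_const !card_ord -mulrnA -[RHS]mulr_natl.
  rewrite -sumrB; apply: ler_sum => i _; rewrite -sumrB; apply: ler_sum => j _.
  exact: q_ge.
exists k, N, n, c; split.
- have cost_q : (\sum_(i < N) \sum_(j < N) grid_plan n c i j *
      (d (s i) (s j) + 2 * r) <= v + 4 * r)%R.
    apply: le_trans cost_m; apply: ler_sum => i _; apply: ler_sum => j _.
    by rewrite ler_wpM2r ?q_le// addr_ge0 ?metric_ge0// mulr_ge0// ltW.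
  rewrite /plan_cost -/r.
  have e4 : ((D + 1) * (g / (4 * (D + 1))) = g / 4)%R.
    by field; rewrite gt_eqF// ltr_wpDl.
  set x := (\sum_(i < N) \sum_(j < N) grid_plan n c i j)%R in sum_q *.
  have x_ge : (1 - x <= g / (4 * (D + 1)) + (N * N)%N%:R / n.+1%:R)%R.
    by move: sum_m sum_q; move: (g / _)%R (_ / n.+1%:R)%R => *; lra.
  have rhs0 : (0 <= g / (4 * (D + 1)) + (N * N)%N%:R / n.+1%:R)%R.
    by rewrite addr_ge0 ?(ltW e0)// divr_ge0.
  have Dx : (D * (1 - x) <= (D + 1) * (g / (4 * (D + 1)) + (N * N)%N%:R / n.+1%:R))%R.
    apply: (le_trans (ler_wpM2l D0 x_ge)); rewrite ler_wpM2r//.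
    by rewrite lerDl.
  move: Dx; rewrite [leRHS]mulrDr e4 => Dx; move: Dx cost_q nN kg.
  move: (\sum_(i < N) _)%R (D * (1 - x))%R ((D + 1) * _)%R => y z w.
  by rewrite -/r /g => *; lra.
- move=> i iN; apply: (@le_trans _ _ (\sum_(j < N) xi (cell r i `*` cell r j))).
    by rewrite -sumEFin; apply: lee_sum => j _; rewrite -mE' lee_fin q_le.
  rewrite -measure_bigsetU_ord//; last first.
    move=> j l _ _ [[x y] [[/= _ yj] [/= _ yl]]].
    by apply/val_inj; exact: cell_inj yj yl.
  have [<- _] := Cxi _ (mC i); apply: measure_subset.
  + exact: bigsetU_measurable.
  + by rewrite -[X in measurable X]setTI; exact: measurable_fst.
  + by move=> z; rewrite -(bigcup_mkord N (fun j => cell r i `*` cell r j)) => -[j _ []].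
- move=> j jN; apply: (@le_trans _ _ (\sum_(i < N) xi (cell r i `*` cell r j))).
    by rewrite -sumEFin; apply: lee_sum => i _; rewrite -mE' lee_fin q_le.
  rewrite -measure_bigsetU_ord//; last first.
    move=> i l _ _ [[x y] [[/= xi' _] [/= xl _]]].
    by apply/val_inj; exact: cell_inj xi' xl.
  have [_ <-] := Cxi _ (mC j); apply: measure_subset.
  + exact: bigsetU_measurable.
  + by rewrite -[X in measurable X]setTI; exact: measurable_snd.
  + by move=> z; rewrite -(bigcup_mkord N (fun i => cell r i `*` cell r j)) => -[i _ []].
Qed.

Lemma measurable_coupling_dist (al : E -> probability E R) (be : probability E R)
    (eps : R) :
  (forall B, measurable B -> measurable_fun [set: E] (fun x => al x B)) ->
  measurable [set x | eps%:E < coupling_dist d (al x) be].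
Proof.
move=> mal; have mlt t : measurable [set x | coupling_dist d (al x) be < t%:E].
  (* The conditions that do not involve [x] only select the plans of the union; the others are
     finitely many measurable constraints on [x]. *)
  pose ok k N n c := (plan_cost k N n c < t)%R /\ forall j, (j < N)%N ->
      (\sum_(i < N) grid_plan n c i j)%:E <= be (cell k.+1%:R^-1 j).
  pose S (p : nat * nat * nat * seq (seq nat)) : set E :=
    let: (k, N, n, c) := p in
    if `[< ok k N n c >] then \bigcap_(i in [set i | (i < N)%N])
      [set x | (\sum_(j < N) grid_plan n c i j)%:E <= al x (cell k.+1%:R^-1 i)]
    else set0.
  have -> : [set x | coupling_dist d (al x) be < t%:E] = \bigcup_p S p.
    apply/seteqP; split => [x /coupling_dist_ltP[k [N [n [c [h1 h2 h3]]]]]|x].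
      by exists (k, N, n, c) => //=; rewrite asboolT.
    move=> [[[[k N] n] c] _ /=]; case: asboolP => // -[h1 h3] h2.
    by apply/coupling_dist_ltP; exists k, N, n, c.
  apply: countable_bigcupT_measurable => // -[[[k N] n] c] /=.
  case: asboolP => // _; apply: bigcap_measurableType => i _.
  rewrite -[X in measurable X]setTI; apply: emeasurable_fun_c_infty => //.
  by apply: mal; exact: measurable_cell.
rewrite (_ : [set x | _] =
    ~` \bigcap_j [set x | coupling_dist d (al x) be < (eps + j.+1%:R^-1)%:E]).
  by apply: measurableC; apply: bigcapT_measurable => j.
apply/seteqP; split => [x /= ex xj|x /= /existsNP[j /not_implyP[_ /negP]]]; last first.
  by rewrite -leNgt; apply: lt_le_trans; rewrite lte_fin ltrDl invr_gt0.
move: ex; rewrite ltNge => /negP; apply; apply/lee_addgt0Pr => e e0.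
apply: (le_trans (ltW (xj (Num.truncn e^-1) I))).
rewrite -EFinD lee_fin lerD2l -[leRHS]invrK lef_pV2 ?posrE ?invr_gt0//.
by rewrite ltW// truncnS_gt.
Qed.

End transport_measurability.

(** * Convergence of the transport distance *)

Section transport_convergence.
Context (R : realType) dE (E : measurableType dE) (d : metric_fun R E).
Hypothesis mE : @measurable dE E = <<s @open (mspace d) >>.
Hypothesis md : measurable_fun [set: E * E] (fun z => d z.1 z.2).
Variables (s : nat -> E).
Hypothesis s_dense : forall x e, (0 < e)%R -> exists n, (d x (s n) < e)%R.
Variable D : R.
Hypothesis dD : forall x y, (d x y <= D)%R.

Local Notation cell := (cell d s).

Lemma sum_cell_small (be : probability E R) (r e : R) : (0 < r)%R -> (0 < e)%R ->
  exists N, (1 - e <= \sum_(i < N) fine (be (cell r i)))%R.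
Proof.
move=> r0 e0; have mC i : measurable (cell r i) by exact: measurable_cell.
pose B N := \bigcup_(i < N) cell r i.
have mB N : measurable (B N) by apply: bigcup_measurable => i _.
have [|||N BN] := @nonincreasing_measure_small _ _ _ be (fun N => ~` B N) e _ _ _ e0.
- by move=> N; exact: measurableC.
- by move=> m n mn x nBx [i /= im xi]; apply: nBx; exists i => //=; exact: leq_trans mn.
- rewrite -subset0 => x nB; have [i xi] := cell_cover s_dense x r0.
  by apply: (nB i.+1 I); exists i => /=.
exists N; have BE : be (B N) = (\sum_(i < N) fine (be (cell r i)))%:E.
  rewrite /B bigcup_mkord measure_bigsetU_ord//.
    by rewrite -sumEFin; apply: eq_bigr => i _; rewrite fineK// fin_num_measure.
  by move=> i j _ _ [x [xi xj]]; apply/val_inj; exact: cell_inj xi xj.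
have := probability_setC be (mB N); move: BN => /[swap] ->.
rewrite BE -EFinB lee_fin; lra.
Qed.

(* Couple through the common mass of each cell. *)
Lemma coupling_dist_cell_le (al be : probability E R) (r : R) N : (0 < r)%R ->
  coupling_dist d al be <= (2 * r + D * (1 - \sum_(i < N) fine (be (cell r i)) +
    \sum_(i < N) `|fine (al (cell r i)) - fine (be (cell r i))|))%:E.
Proof.
move=> r0; pose a i := fine (al (cell r i)); pose b i := fine (be (cell r i)).
have mC i : measurable (cell r i) by exact: measurable_cell.
have aE i : (a i)%:E = al (cell r i) by rewrite fineK// fin_num_measure.
have bE i : (b i)%:E = be (cell r i) by rewrite fineK// fin_num_measure.
have a0 i : (0 <= a i)%R by rewrite -lee_fin aE.
have b0 i : (0 <= b i)%R by rewrite -lee_fin bE.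
pose q (i j : nat) : R := if i == j then Num.min (a i) (b i) else 0%R.
have q0 i j : (0 <= q i j)%R by rewrite /q; case: ifP => // _; rewrite le_min a0 b0.
have sumq i : (i < N)%N -> (\sum_(j < N) q i j = Num.min (a i) (b i))%R.
  move=> iN; rewrite (bigD1 (Ordinal iN))//= /q eqxx big1 ?addr0// => j.
  by rewrite -val_eqE/= eq_sym => /negbTE ->.
have sumq' j : (j < N)%N -> (\sum_(i < N) q i j = Num.min (a j) (b j))%R.
  move=> jN; rewrite (bigD1 (Ordinal jN))//= /q eqxx big1 ?addr0// => i.
  by rewrite -val_eqE/= => /negbTE ->.
have D0 : (0 <= D)%R by rewrite -(metric_xx d (s 0%N)); exact: dD.
have qal i : (i < N)%N -> (\sum_(j < N) q i j)%:E <= al (cell r i).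
  by move=> iN; rewrite sumq// -aE lee_fin ge_min lexx.
have qbe j : (j < N)%N -> (\sum_(i < N) q i j)%:E <= be (cell r j).
  by move=> jN; rewrite sumq'// -bE lee_fin ge_min lexx orbT.
apply: le_trans (coupling_dist_plan mE md dD q0 qal qbe) _.
rewrite lee_fin lerD//.
  (* Only diagonal entries are nonzero, and [d (s i) (s i) = 0] leaves the surcharge [2 * r]. *)
  apply: (@le_trans _ _ (\sum_(i < N) b i * (2 * r))%R).
    apply: ler_sum => i _; rewrite (bigD1 i)//= big1 ?addr0 => [|j].
      by rewrite /q eqxx metric_xx add0r ler_wpM2r ?mulr_ge0 ?(ltW r0)// ge_min lexx orbT.
    by rewrite /q -val_eqE/= eq_sym => /negbTE ->; rewrite mul0r.
  rewrite -mulr_suml ler_piMl ?mulr_ge0 ?(ltW r0)//.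
  rewrite -lee_fin -(@probability_setT _ _ _ be) -sumEFin.
  rewrite (eq_bigr (fun i : 'I_N => be (cell r i))) => [|i _]; last exact: bE.
  rewrite -measure_bigsetU_ord//.
    by apply: measure_subset => //; exact: bigsetU_measurable.
  by move=> i j _ _ [x [xi xj]]; apply/val_inj; exact: cell_inj xi xj.
rewrite ler_wpM2l// (eq_bigr (fun i : 'I_N => Num.min (a i) (b i))) => [|i _]; last exact: sumq.
have : (\sum_(i < N) b i <= \sum_(i < N) Num.min (a i) (b i) + \sum_(i < N) `|a i - b i|)%R.
  rewrite -big_split/=; apply: ler_sum => i _.
  have := ler_norm (b i - a i)%R; rewrite distrC; have := normr_ge0 (a i - b i)%R.
  by case: (leP (a i) (b i)) => *; lra.
rewrite /a /b; lra.
Qed.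

Variables (P : R.-pker E ~> E) (Pr : E -> probability (paths E) R).
Hypothesis Pr_law : forall x, markov_law P x (Pr x).
Variable mu : probability E R.
Hypothesis mu_inv : invariant_prob P mu.
Variable M : set (E * E).
Hypothesis mM : measurable M.
Hypothesis M1 : (mu \x mu) M = 1.
Hypothesis M_cond : forall x y, M (x, y) -> cond_i d (Pr x) (Pr y).

Lemma coupling_dist_state_law_cvg (eps : R) : (0 < eps)%R ->
  mu [set x | eps%:E < coupling_dist d (state_law Pr n x) mu] @[n --> \oo] --> 0.
Proof.
move=> eps0; have D0 : (0 <= D)%R by rewrite -(metric_xx d (s 0%N)); exact: dD.
have D1 : (0 < D + 1)%R by rewrite ltr_wpDl.
pose W n := [set x | eps%:E < coupling_dist d (state_law Pr n x) mu].
have mW n : measurable (W n).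
  apply: (measurable_coupling_dist mE md s_dense dD) => B mB.
  exact: (measurable_state_law Pr_law).
(* The cells cost [2 * r = eps / 4] and the mass left outside them at most [eps / 4], so on [W n]
   the cell discrepancies [f n] must account for the remaining [eps / 2]. *)
pose r := (eps / 8)%R; have r0 : (0 < r)%R by rewrite divr_gt0.
have mC i : measurable (cell r i) by exact: measurable_cell.
have e0 : (0 < eps / (4 * (D + 1)))%R by rewrite divr_gt0// mulr_gt0.
have [N sumN] := sum_cell_small mu r0 e0.
pose f n x := (\sum_(i < N) `|hit Pr (cell r i) n x - fine (mu (cell r i))|)%R.
have f0 n x : (0 <= f n x)%R by exact: sumr_ge0.
have mfi n i : measurable_fun setT
    (fun x => `|hit Pr (cell r i) n x - fine (mu (cell r i))|%R).
  apply: measurableT_comp => //; apply: measurable_funB => //.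
  exact: (measurable_hit Pr_law (mC i)).
have mf n : measurable_fun setT (f n) by apply: measurable_sum => i; exact: mfi.
have W_f n x : W n x -> (eps / (2 * (D + 1)) <= f n x)%R.
  move=> Wx; have := lt_le_trans Wx (coupling_dist_cell_le _ mu N r0).
  rewrite lte_fin -/(f n x) leNgt => h; apply/negP.
  rewrite ltr_pdivlMr ?mulr_gt0// => fx.
  move: sumN; rewrite lerBlDl -lerBlDr ler_pdivlMr ?mulr_gt0//.
  move: h fx; rewrite /r.
  have := f0 n x; move: (f n x) (\sum_(i < N) _)%R => u v u0 h fx vE.
  have Du : (D * u <= (D + 1) * u)%R by rewrite ler_wpM2r// lerDl.
  nra.
have W_le n : (eps / (2 * (D + 1)))%:E * mu (W n) <= \int[mu]_x (f n x)%:E.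
  have c0 : (0 < eps / (2 * (D + 1)))%R by rewrite divr_gt0// mulr_gt0.
  have mfE : measurable_fun setT (EFin \o f n) by exact/measurable_EFinP.
  have := le_integral_abse mu measurableT mfE c0.
  under eq_integral do rewrite gee0_abs ?lee_fin//.
  apply: le_trans; rewrite lee_wpmul2l ?lee_fin ?(ltW c0)//.
  apply: measure_subset => //.
    by apply: emeasurable_fun_c_infty => //; apply: measurableT_comp.
  by move=> x /W_f Wx; split => //=; rewrite lee_fin ger0_norm.
apply/fine_cvgP; split.
  by apply: nearW => n; apply: fin_num_measure; exact: mW.
apply/cvgr0Pnorm_le => t t0.
(* [N] errors of size [t'] stay below [t] times the threshold in [W_le]; [N.+1] avoids a division by
   zero. *)
pose t' := (t * eps / (2 * (D + 1) * N.+1%:R))%R.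
have t'0 : (0 < t')%R by rewrite divr_gt0 ?mulr_gt0.
have /choice[K hitK] := fun i =>
  hit_cvg mE md Pr_law mu_inv (mC i) mM M1 M_cond t'0.
exists (\max_(i < N) K i) => // n /= Kn.
rewrite ger0_norm ?fine_ge0//= -lee_fin -/(W n) fineK ?fin_num_measure//.
have c0 : (0 < eps / (2 * (D + 1)))%R by rewrite divr_gt0// mulr_gt0.
rewrite -(@lee_pmul2l _ (eps / (2 * (D + 1)))%:E)//.
apply: (le_trans (W_le n)).
under eq_integral do rewrite /f -sumEFin.
rewrite ge0_integral_sum//; last first.
  by move=> i; apply/measurable_EFinP; exact: mfi.
apply: (@le_trans _ _ (\sum_(i < N) t'%:E)).
  apply: lee_sum => i _; apply: hitK; apply: leq_trans Kn.
  exact: (@leq_bigmax_cond _ predT (fun i : 'I_N => K i) i isT).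
rewrite sumEFin lee_fin sumr_const card_ord -[leLHS]mulr_natr.
have -> : (t' * N%:R = (eps / (2 * (D + 1)) * t) * (N%:R / N.+1%:R))%R.
  have : (N.+1%:R != 0 :> R)%R by rewrite pnatr_eq0.
  by rewrite /t'; move: (N.+1%:R)%R => u u0; field; rewrite u0 (gt_eqF D1).
apply: ler_piMr; first by rewrite mulr_ge0// ltW.
by rewrite ler_pdivrMr// mul1r ler_nat.
Qed.

End transport_convergence.

(** * Assembly of both parts *)

Lemma eq_coupling_dist (R : realType) dE (E : measurableType dE)
    (d : metric_fun R E) (m1 m2 nu : set E -> \bar R) :
  (forall A, measurable A -> m1 A = m2 A) ->
  coupling_dist d m1 nu = coupling_dist d m2 nu.
Proof.
move=> m12; rewrite /coupling_dist; congr (ereal_inf [set _ | _ in _]).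
by apply/seteqP; split => xi Cxi A mA; have [? ?] := Cxi A mA; rewrite ?m12// -?m12.
Qed.

Theorem theorem2p3 (R : realType) (dE : measure_display) (E : measurableType dE)
    (rho d : metric_fun R E) (Ebar : metricType R) (iota : mspace d -> Ebar)
    (P : R.-pker E ~> E) (Pr : E -> probability (paths E) R)
    (rho_complete : metric_complete (mspace rho))
    (rho_separable : separable (mspace rho))
    (rho_le1 : forall x y, (rho x y <= 1)%R)
    (borelE : @measurable dE E = <<s @open (mspace rho) >>)
    (d_bounded : exists c : R, forall x y, (d x y <= c)%R)
    (d_continuous : continuous
       (fun z : (mspace rho * mspace rho)%type => d z.1 z.2 : R))
    (iota_completion : is_completion iota)
    (rho_approx : completion_approx rho iota)
    (Pr_law : forall x, markov_law P x (Pr x)) :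
  (feller d P ->
   forall mu : probability E R, invariant_prob P mu ->
   forall M : set (E * E), measurable M -> (mu \x mu) M = 1 ->
   (forall x y, M (x, y) -> cond_i d (Pr x) (Pr y)) ->
   forall eps : R, (0 < eps)%R ->
     (forall n, measurable [set x | eps%:E < coupling_dist d (nstep P n x) mu])
     /\ mu [set x | eps%:E < coupling_dist d (nstep P n x) mu]
          @[n --> \oo] --> 0)
  /\
  (forall x y : E,
     (cond_i d (Pr x) (Pr y) <-> cond_ii d (Pr x) (Pr y)) /\
     (cond_iii d (Pr x) (Pr y) -> cond_ii d (Pr x) (Pr y)) /\
     (cond_iii d (Pr x) (Pr y) -> cond_i d (Pr x) (Pr y))).
Proof.
have d_rho := continuous_metric_open d_continuous.
(* The dense sequence needs a point. In Part II it is the given [x]; in Part I it exists because [E]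
   carries a probability. *)
have mE (x0 : E) : @measurable dE E = <<s @open (mspace d) >>.
  have [s s_dense] := dense_sequence x0 (fun A oA => oA) rho_separable.
  have [_ iota_iso _] := iota_completion.
  exact: completion_approx_measurable iota_iso rho_approx borelE d_rho s_dense.
have md (x0 : E) : measurable_fun [set: E * E] (fun z => d z.1 z.2).
  have [s s_dense] := dense_sequence x0 d_rho rho_separable.
  exact: measurable_metric (mE x0) s_dense.
split=> [_ mu mu_inv M mM M1 M_cond eps eps0|x y]; last first.
  have i_ii := cond_i_iff_ii (md x) (Pr x) (Pr y).
  have iii_i := @cond_iii_i _ _ _ _ (md x) (Pr x) (Pr y).
  by split=> //; split=> // /iii_i/i_ii.
have [x0 _] : [set: E] !=set0.
  apply/set0P/negP => /eqP E0; have := @probability_setT _ _ _ mu.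
  by rewrite E0 measure0 => /eqP; rewrite eq_sym onee_eq0.
have [s s_dense] := dense_sequence x0 d_rho rho_separable.
have [D dD] := d_bounded.
have WE n : [set x | eps%:E < coupling_dist d (nstep P n x) mu] =
    [set x | eps%:E < coupling_dist d (state_law Pr n x) mu].
  have distE x : coupling_dist d (nstep P n x) mu =
      coupling_dist d (state_law Pr n x) mu.
    by apply: eq_coupling_dist => A mA; exact: (nstep_state_law Pr_law).
  by apply/seteqP; split=> x /=; rewrite distE.
split=> [n|].
  rewrite WE; apply: (measurable_coupling_dist (mE x0) (md x0) s_dense dD) => B mB.
  exact: (measurable_state_law Pr_law).
under eq_fun do rewrite WE.
exact: (coupling_dist_state_law_cvg (mE x0) (md x0) s_dense dD Pr_law mu_inv mM M1 M_cond).
Qed.
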